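(* There exist absolute constants $c>0$ and $k_0$ such that for every $k\ge k_0$ and every bivariate polynomial $f(x,y)\in\mathbb{C}[x,y]$ whose Newton polytope $\mathrm{Newt}(f)$ has exactly $k$ vertices, there exists $a\in\mathbb{C}\setminus\{0\}$ such that the univariate polynomial $f(x,a)$ satisfies $B(f(x,a))\ge c\sqrt k$.
   Context: For $f(x,y)=\sum_{i,j}a_{i,j}x^iy^j$, $\mathrm{supp}(f):=\{(i,j):a_{i,j}\ne0\}$ and $\mathrm{Newt}(f)\subseteq\mathbb{R}^2$ is the convex hull of $\mathrm{supp}(f)$. For a univariate complex polynomial $g$ with non-zero roots $r_1e^{\imath\phi_1},\dots,r_ne^{\imath\phi_n}$ (listed with multiplicity, $r_i>0$, $\phi_i\in[0,2\pi)$), the bias is $$B(g):=\sup_{0\le\alpha\le\beta\le2\pi}\Big|N_{\alpha,\beta}(g)-\frac{n(\beta-\alpha)}{2\pi}\Big|,$$ where $N_{\alpha,\beta}(g)$ is the number of these roots (with multiplicity) with $\phi_i\in[\alpha,\beta]$. *)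

(* Defs.v *)
From Stdlib Require Import Reals Lra List ClassicalEpsilon.
Open Scope R_scope.

Definition Cx := (R * R)%type.
Definition C0 : Cx := (0, 0).
Definition C1 : Cx := (1, 0).
Definition Cadd (z w : Cx) : Cx := (fst z + fst w, snd z + snd w).
Definition Csub (z w : Cx) : Cx := (fst z - fst w, snd z - snd w).
Definition Cmul (z w : Cx) : Cx :=
  (fst z * fst w - snd z * snd w, fst z * snd w + snd z * fst w).
Fixpoint Cpow (z : Cx) (n : nat) : Cx :=
  match n with O => C1 | S m => Cmul z (Cpow z m) end.
Definition Cmod (z : Cx) : R := sqrt (fst z * fst z + snd z * snd z).

Definition has_arg (z : Cx) (phi : R) : Prop :=
  0 <= phi < 2 * PI /\ fst z = Cmod z * cos phi /\ snd z = Cmod z * sin phi.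

(* A bivariate polynomial f(x,y) = sum a_{ij} x^i y^j is given by its
   coefficient function a : nat -> nat -> Cx, with all coefficients vanishing
   outside [0,D) x [0,D). *)
Definition finite_support (a : nat -> nat -> Cx) (D : nat) : Prop :=
  forall i j, (D <= i)%nat \/ (D <= j)%nat -> a i j = C0.

Fixpoint Csum (n : nat) (F : nat -> Cx) : Cx :=
  match n with O => C0 | S m => Cadd (Csum m F) (F m) end.

Definition eval2 (a : nat -> nat -> Cx) (D : nat) (x y : Cx) : Cx :=
  Csum D (fun i => Csum D (fun j => Cmul (a i j) (Cmul (Cpow x i) (Cpow y j)))).

Definition supp (a : nat -> nat -> Cx) (p : nat * nat) : Prop :=
  a (fst p) (snd p) <> C0.

Definition pt (p : nat * nat) : R * R := (INR (fst p), INR (snd p)).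

Definition in_conv_hull (S : nat * nat -> Prop) (q : R * R) : Prop :=
  exists ws : list ((nat * nat) * R),
    Forall (fun pw => S (fst pw) /\ 0 <= snd pw) ws /\
    fold_right (fun pw s => snd pw + s) 0 ws = 1 /\
    fold_right (fun pw s => snd pw * fst (pt (fst pw)) + s) 0 ws = fst q /\
    fold_right (fun pw s => snd pw * snd (pt (fst pw)) + s) 0 ws = snd q.

(* vertices of Newt(f) = conv(supp f): the points of supp f that are extreme,
   i.e. not in the convex hull of the remaining points of supp f *)
Definition newt_vertex (a : nat -> nat -> Cx) (p : nat * nat) : Prop :=
  supp a p /\ ~ in_conv_hull (fun q => supp a q /\ q <> p) (pt p).

Definition newt_num_vertices (a : nat -> nat -> Cx) (k : nat) : Prop :=
  exists vs : list (nat * nat),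
    NoDup vs /\ length vs = k /\ (forall p, In p vs <-> newt_vertex a p).

Definition Cprod_lin (z : Cx) (rs : list Cx) : Cx :=
  fold_right (fun r acc => Cmul (Csub z r) acc) C1 rs.

(* g (given as a function Cx -> Cx) factors as c * z^m * prod_{r in rs} (z - r)
   with c <> 0 and all r <> 0; rs is then the list of nonzero roots of g
   with multiplicity. *)
Definition nonzero_roots (g : Cx -> Cx) (rs : list Cx) : Prop :=
  exists (c : Cx) (m : nat), c <> C0 /\ Forall (fun r => r <> C0) rs /\
    forall z, g z = Cmul c (Cmul (Cpow z m) (Cprod_lin z rs)).

Definition decP (P : Prop) : bool :=
  if excluded_middle_informative P then true else false.

Definition N_ab (alpha beta : R) (rs : list Cx) : nat :=
  length (filter (fun r => decP (exists phi, has_arg r phi /\ alpha <= phi <= beta)) rs).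

Definition bias_set (rs : list Cx) (v : R) : Prop :=
  exists alpha beta, 0 <= alpha <= beta /\ beta <= 2 * PI /\
    v = Rabs (INR (N_ab alpha beta rs) - INR (length rs) * (beta - alpha) / (2 * PI)).

Definition is_bias (rs : list Cx) (b : R) : Prop := is_lub (bias_set rs) b.

(* Main.v *)
(** Put [y = exp (- n) * cis theta] and let [n] tend to infinity.  Each edge [e] of the
    lower hull of the Newton polygon contributes [width e] roots of [f(x, y)], and after
    rescaling by [exp (n * slope e)] these converge to the nonzero roots of the edge
    polynomial rotated by the angle [- slope e * theta].  As [theta] varies the edges
    rotate at pairwise distinct speeds, so their angular discrepancies are orthogonal on
    average: the mean square of the total discrepancy is the sum of the mean squares.
    Each of these is bounded below, because counting functions are integer valued while
    the expected counts are not.  Restricting [theta] and the ends of the sectors to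
    multiples of [2 * PI / M], with [M] a large prime, turns the averages into finite sums
    over the field with [M] elements.  The lower hull of [f], or that of [f(x, 1 / y)],
    carries at least half of the vertices. *)

From Stdlib Require Import Reals Lra Lia ZArith Arith FinFun ClassicalEpsilon.
From Coquelicot Require Import Coquelicot.
From Stdlib Require Import List Permutation.
From mathcomp Require all_boot all_order all_algebra zify ring lra complex Rstruct.
Require Import Defs.
Open Scope R_scope.

(** Passing to the limit bounds the number of roots in an open set only from below: limit roots may
    sit on its boundary, and the roots belonging to other edges escape to 0 or infinity. The bound
    is therefore applied to a sector and to the complementary one at the same time. The two limit
    counts already add up to the number of nonzero roots of f(x, y), so both inequalities are
    equalities. This needs every rotated limit root to avoid the boundary rays, which a common
    offset [d] of the rays ensures. The constants come from one edge. Scaled by [M], the discrepancy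
    of w points up to t is congruent to - w t modulo [M]; for a suitable s its values at t and t + s
    differ by (M - 1) / 2 modulo [M], hence by at least M / 3. Its mean square about its mean is
    then at least (M / 6)^2, and l edges give a bias of at least sqrt l / 6. For k >= 4 one of the
    two chains has l >= k / 4 edges, whence 1 / 12. Primality makes both w and the differences of
    the rotation speeds invertible modulo [M]; [M] is taken larger than the widths and than those
    differences. The angles theta are multiples of 2 pi D! / M, so that each edge turns by a whole
    number of grid steps. *)

Definition in_window (M a b : nat) (y : nat) : bool :=
  andb (Nat.leb a (Nat.modulo y M)) (Nat.ltb (Nat.modulo y M) b).

(** * Discrepancy of residues modulo a prime *)
Module Residues.

Import all_boot all_order all_algebra zify ring lra.
Set Implicit Arguments. Unset Strict Implicit. Unset Printing Implicit Defensive.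
Import Order.TTheory GRing.Theory Num.Theory.
Local Open Scope ring_scope.

(** After translating [u] by [p e * v], a cross term pairs [H e u] with
    [H e' (u + (p e - p e') * v)]. Since [p e - p e'] is invertible, [v] drives the second argument
    through all of [F], and the zero mean of [H e'] kills the sum. A diagonal term does not depend
    on [v] after the same translation, hence the factor [#|F|]. *)
Lemma rotation_orthogonality (R : realFieldType) (F : finFieldType) (I : eqType)
    (es : seq I) (p : I -> F) (H : I -> F -> R) :
    uniq es -> {in es &, injective p} -> (forall e, \sum_t H e t = 0) ->
  \sum_v \sum_u (\sum_(e <- es) H e (u - p e * v)) ^+ 2 =
    #|F|%:R * \sum_(e <- es) \sum_t (H e t) ^+ 2.
Proof.
move=> es_uniq p_inj H0.
have cross e e' : e \in es -> e' \in es -> e != e' ->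
    \sum_v \sum_u H e (u - p e * v) * H e' (u - p e' * v) = 0.
  move=> ee ee' ne.
  have dp : p e - p e' != 0.
    by apply: contraNneq ne => /eqP; rewrite subr_eq0 => /eqP /p_inj ->.
  transitivity (\sum_v \sum_u H e u * H e' (u + (p e - p e') * v)).
    apply: eq_bigr => v _.
    rewrite (reindex_inj (addIr (p e * v))) /=; apply: eq_bigr => u _.
    by congr (H e _ * H e' _); ring.
  rewrite exchange_big /= big1 // => u _.
  rewrite -mulr_sumr; suff -> : \sum_v H e' (u + (p e - p e') * v) = 0.
    by rewrite mulr0.
  rewrite -[RHS](H0 e') [RHS](reindex_inj (addrI u)) /=.
  by rewrite [RHS](reindex_inj (mulfI dp)).
under eq_bigr => v _.
  under eq_bigr => u _.
    rewrite expr2 mulr_suml.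
    under eq_bigr => e _ do rewrite mulr_sumr.
    over.
  rewrite exchange_big /=.
  under eq_bigr => e _ do rewrite exchange_big.
  over.
rewrite exchange_big /=.
under eq_bigr => e _ do rewrite exchange_big.
rewrite big_seq [in RHS]big_seq mulr_sumr; apply: eq_bigr => e ee.
rewrite (bigD1_seq e) //= [X in _ + X]big_seq_cond [X in _ + X]big1 ?addr0.
  under eq_bigr => v _.
    rewrite (reindex_inj (addIr (p e * v))) /=.
    under eq_bigr => u _ do rewrite addrK -expr2.
    over.
  by rewrite sumr_const mulr_natl.
by move=> e' /andP[ee' ne]; apply: cross; rewrite // eq_sym.
Qed.

Section ResidueDiscrepancy.
Variable M : nat.
Hypotheses (pM : prime M) (M2 : (2 < M)%N).
Implicit Types (X : seq 'F_M) (t q : 'F_M).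

Let M1 : (1 < M)%N. Proof. exact: prime_gt1. Qed.
Let MF : (Zp_trunc (pdiv M)).+2 = M. Proof. exact: Fp_cast. Qed.
Let M0R : M%:R != 0 :> rat. Proof. by rewrite pnatr_eq0; case: M M1. Qed.

(* Scaled by [M] to be integer valued. *)
Definition cdisc X t : int :=
  (M * count (fun x : 'F_M => (x < t)%N) X)%:Z - (size X * t)%:Z.

Lemma ltn_Fp t : (t < M)%N.
Proof. by have := ltn_ord t; rewrite [X in (_ < X)%N]MF. Qed.

(** Modulo [M] the counting term disappears and only the number of points is left, whatever their
    position. This is the integrality that prevents the discrepancy from being small everywhere. *)
Lemma cdisc_residue X t : (cdisc X t)%:~R = - (size X)%:R * t :> 'F_M.
Proof.
rewrite /cdisc intrB -!pmulrn !natrM pchar_Fp_0 // mul0r sub0r mulNr.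
by rewrite natr_Zp.
Qed.

Lemma val_Fp_nat k : (k < M)%N -> (k%:R : 'F_M) = k :> nat.
Proof. by move=> kM; rewrite val_Fp_nat // modn_small. Qed.

(** The step from [M - 1] to [0] obeys the same rule, because the discrepancy continued to [M] would
    be [M * size X - size X * M = 0]. So [cdisc] is a well-behaved function on the cyclic group. *)
Lemma cdisc_succ X t :
  cdisc X (t + 1) - cdisc X t = (M * count_mem t X)%:Z - (size X)%:Z.
Proof.
rewrite /cdisc.
have [tM|tM] := ltnP t.+1 M.
  have -> : (t + 1 : 'F_M) = t.+1 :> nat.
    by rewrite -[t in t + 1]natr_Zp natr1 val_Fp_nat.
  have -> : count (fun x : 'F_M => (x < t.+1)%N) X =
      (count (fun x : 'F_M => (x < t)%N) X + count_mem t X)%N.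
    elim: X => //= x X ->.
    rewrite ltnS leq_eqVlt (inj_eq val_inj).
    case: eqVneq => [->|]; rewrite ?ltnn ?orbT /=; lia.
  nia.
have tE : M = t.+1 by have := ltn_Fp t; lia.
have -> : (t + 1 : 'F_M) = 0.
  by rewrite -[t]natr_Zp natr1 -tE pchar_Fp_0.
have -> : count (fun x : 'F_M => (x < (0%R : 'F_M))%N) X = 0%N.
  by rewrite -[RHS](count_pred0 X); apply: eq_count.
have : (count (fun x : 'F_M => (x < t)%N) X + count_mem t X = size X)%N.
  elim: X => //= x X <-.
  have := ltn_Fp x; rewrite [X in (_ < X)%N]tE ltnS leq_eqVlt (inj_eq val_inj).
  case: eqVneq => [->|] /=; rewrite ?ltnn; lia.
have z0 : nat_of_ord (0%R : 'F_M) = 0%N by [].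
rewrite z0 muln0; move: (count _ X) (count_mem t X) (size X) => c m s.
move: (nat_of_ord t) tE => k ME cms.
nia.
Qed.

(** Induction on the length of the window: the points [a - q] and [b - q] may lie on different sides
    of 0, but each single step is covered by [cdisc_succ], wrap included. *)
Lemma cdisc_window X q a b : (a <= b < M)%N ->
  cdisc X (b%:R - q) - cdisc X (a%:R - q) =
    (M * count (fun x : 'F_M => (a <= (x + q)%R < b)%N) X)%:Z
    - (size X * (b - a))%:Z.
Proof.
move=> /andP[ab bM]; rewrite -(subnKC ab) in bM *.
elim: (b - a)%N bM => [|k IH] bM.
  rewrite addn0 subnn subrr muln0 subr0.
  rewrite (eq_count (a2 := pred0)) ?count_pred0 ?muln0 // => x /=.
  by apply/negP; lia.
have -> : (a + k.+1)%:R - q = ((a + k)%:R - q) + 1 :> 'F_M.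
  by rewrite addnS -natr1; ring.
have /eqP := cdisc_succ X ((a + k)%:R - q); rewrite subr_eq => /eqP ->.
rewrite -addrA IH; last by lia.
have -> : count (fun x : 'F_M => (a <= (x + q)%R < a + k.+1)%N) X =
   (count (fun x : 'F_M => (a <= (x + q)%R < a + k)%N) X
    + count_mem ((a + k)%:R - q)%R X)%N.
  have cnt (f : 'F_M -> nat) (g : pred 'F_M) c Y :
      (forall x, g x = (f x == c)) -> (a <= c)%N ->
      count (fun x => a <= f x < c.+1)%N Y =
        (count (fun x => a <= f x < c)%N Y + count g Y)%N.
    move=> gE ac; elim: Y => //= x Y ->; rewrite gE.
    case: (f x =P c) => [->|]; lia.
  rewrite addnS; apply: cnt; last exact: leq_addr.
  move=> x; rewrite /= eq_sym subr_eq eq_sym -(inj_eq val_inj).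
  by congr (_ == _); apply: val_Fp_nat; lia.
by rewrite !addKn mulnS mulnDr !PoszD; ring.
Qed.

(** By [cdisc_residue] the difference is congruent to [- size X * s]. The choice of [s] makes it (M
    - 1) / 2 modulo [M], as far from 0 as a residue can be. Every integer in that class has absolute
    value at least (M - 1) / 2, which is at least M / 3 since M >= 3. *)
Lemma cdisc_half_turn X : (0 < size X < M)%N ->
  exists s : 'F_M, forall t,
    (M ^ 2)%:Z <= 9 * (cdisc X (t + s) - cdisc X t) ^+ 2.
Proof.
move=> /andP[X0 XM].
have Xu : (size X)%:R != 0 :> 'F_M.
  apply/eqP => /(congr1 val) /=; rewrite val_Fp_nat //; lia.
have modd : odd M by case: (even_prime pM) => // E; move: M2; rewrite E.
have Mh : M = (M./2.*2).+1 by rewrite -[LHS]odd_double_half modd.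
exists (- (M./2)%:R / (size X)%:R) => t.
set d := cdisc X _ - _.
have dE : (d - (M./2)%:Z)%:~R = 0 :> 'F_M.
  rewrite /d 2!intrB !cdisc_residue -pmulrn; field.
  by rewrite Xu.
have /dvdzP[k kE] : (M%:Z %| d - (M./2)%:Z)%Z.
  by rewrite (dvdz_pcharf (pchar_Fp pM)) dE.
have [d3|d3] : M%:Z <= 3 * d \/ M%:Z <= - (3 * d).
- move: d dE kE => d _; move: (M./2) Mh => h Mh kE.
  by have [k0|k0] := lerP 0 k; [left|right]; nia.
- nia.
- nia.
Qed.

Lemma rotated_discrepancy (I : eqType) (es : seq I) (p : I -> 'F_M)
    (X : I -> seq 'F_M) :
    (0 < size es)%N -> uniq es -> {in es &, injective p} ->
    (forall e, e \in es -> 0 < size (X e) < M)%N ->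
  exists (v : 'F_M) (a b : nat), (a < b < M)%N /\
    (size es * M ^ 2)%:Z <= 36 * (\sum_(e <- es)
      ((M * count (fun x : 'F_M => (a <= (x + p e * v)%R < b)%N) (X e))%:Z
       - (size (X e) * (b - a))%:Z)) ^+ 2.
Proof.
move=> es0 es_uniq p_inj Xsz.
(* Centring gives the zero mean that orthogonality requires; the means cancel again when the values
   at the two ends of a window are subtracted. *)
pose mean e : rat := (\sum_t (cdisc (X e) t)%:~R) / M%:R.
pose H e t : rat := (cdisc (X e) t)%:~R - mean e.
have H0 e : \sum_t H e t = 0.
  by rewrite sumrB sumr_const card_Fp // -mulr_natr divfK // subrr.
(* Sum over [t] the inequality 9 (x - y)^2 <= 18 ((x - m)^2 + (y - m)^2), with x and y the values at
   [t + s] and [t] and m the mean. The left side is at least M^2 for each of the [M] values of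
   [t]. *)
have H2 e : e \in es -> M%:R ^+ 3 <= 36 * \sum_t H e t ^+ 2.
  move=> ee; have [s sP] := cdisc_half_turn (Xsz e ee).
  have -> : 36 * \sum_t H e t ^+ 2 =
      \sum_t 18 * (H e (t + s) ^+ 2 + H e t ^+ 2).
    rewrite -mulr_sumr big_split /=.
    have -> : \sum_t H e (t + s) ^+ 2 = \sum_t H e t ^+ 2.
      by rewrite [RHS](reindex_inj (addIr s)).
    by ring.
  have -> : M%:R ^+ 3 = \sum_(t : 'F_M) M%:R ^+ 2 :> rat.
    by rewrite sumr_const card_Fp // -[RHS]mulr_natr -exprSr.
  apply: ler_sum => t _.
  move: (sP t); rewrite -(ler_int rat) expr2 2!intrM intrB -expr2 -!pmulrn natrX.
  rewrite /H; move: (mean e) (_%:~R) (_%:~R) => m x y xy.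
  apply: le_trans xy _; rewrite -subr_ge0.
  set z := (X in 0 <= X); have -> : z = 9 * (x + y - m - m) ^+ 2 by rewrite /z; ring.
  by rewrite mulr_ge0 ?sqr_ge0.
pose T (v u : 'F_M) : rat := \sum_(e <- es) H e (u - p e * v).
(* There are M^2 pairs [(v, u)], and the squares [T v u ^+ 2] add up to at least
   [size es * M ^ 4 / 36]; some pair reaches the average. *)
have [v [u Tvu]] : exists v u, (size es * M ^ 2)%:R <= 36 * T v u ^+ 2.
  suff: [exists v, exists u, (size es * M ^ 2)%:R <= 36 * T v u ^+ 2].
    by move=> /existsP[v /existsP[u Tvu]]; exists v, u.
  apply: contraT => /existsPn nT.
  have {}nT v u : 36 * T v u ^+ 2 < (size es * M ^ 2)%:R.
    by rewrite ltNge; have /existsPn/(_ u) := nT v.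
  have S1 : \sum_v \sum_u T v u ^+ 2 = M%:R * \sum_(e <- es) \sum_t H e t ^+ 2.
    by rewrite rotation_orthogonality // card_Fp.
  have S2 : (size es)%:R * M%:R ^+ 3 <= 36 * \sum_(e <- es) \sum_t H e t ^+ 2.
    have -> : (size es)%:R * M%:R ^+ 3 = \sum_(e <- es) M%:R ^+ 3 :> rat.
      by rewrite big_const_seq count_predT iter_addr_0 mulr_natl.
    by rewrite mulr_sumr !big_seq; apply: ler_sum => e; exact: H2.
  have S3 c : \sum_(v : 'F_M) \sum_(u : 'F_M) c = M%:R * (M%:R * c) :> rat.
    by rewrite !sumr_const card_Fp // !mulr_natl.
  have : \sum_v \sum_u 36 * T v u ^+ 2 <
      \sum_(v : 'F_M) \sum_(u : 'F_M) (size es * M ^ 2)%:R.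
    apply: ltr_sum => [|v _]; first by apply/hasP; exists 0; rewrite // mem_index_enum.
    by apply: ltr_sum => [|u _]; first by apply/hasP; exists 0; rewrite // mem_index_enum.
  have -> : \sum_v \sum_u 36 * T v u ^+ 2 = 36 * \sum_v \sum_u T v u ^+ 2.
    by rewrite mulr_sumr; apply: eq_bigr => v _; rewrite mulr_sumr.
  rewrite S1 S3 natrM natrX mulrCA ltr_pM2l ?ltr0n ?(ltnW M1) //.
  by rewrite mulrCA -exprS ltNge S2.
have T0 : \sum_u T v u = 0.
  rewrite exchange_big big1 // => e _; rewrite -[RHS](H0 e).
  by rewrite [RHS](reindex_inj (addIr (- (p e * v)))).
(* The other end of the window is taken where [T v] vanishes or has the opposite sign, so that the
   difference of the two values is at least as large as [T v u] and the constant 36 is not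
   worsened. *)
have [u' Tu'] : exists u', T v u * T v u' <= 0.
  apply/existsP; apply: contraT => /existsPn nT.
  have : 0 < \sum_u' T v u * T v u'.
    have nT' w : 0 < T v u * T v w by rewrite ltNge nT.
    by rewrite (bigD1 u) //= ltr_wpDr // sumr_ge0 // => w _; rewrite ltW.
  by rewrite -mulr_sumr T0 mulr0 ltxx.
have Tdiff : (size es * M ^ 2)%:R <= 36 * (T v u - T v u') ^+ 2.
  apply: le_trans Tvu _; rewrite ler_pM2l //.
  by nra.
have Tpos : 0 < (size es * M ^ 2)%:R :> rat.
  by rewrite ltr0n muln_gt0 es0 expn_gt0; lia.
have uu' : u != u'.
  by apply/eqP => E; move: Tdiff; rewrite -E subrr expr0n mulr0 leNgt Tpos.
have window (x y : 'F_M) : (x < y)%N -> (size es * M ^ 2)%:R <= 36 * (T v y - T v x) ^+ 2 ->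
   (size es * M ^ 2)%:Z <= 36 * (\sum_(e <- es)
      ((M * count (fun z : 'F_M => (x <= (z + p e * v)%R < y)%N) (X e))%:Z
       - (size (X e) * (y - x))%:Z)) ^+ 2.
  move=> xy Txy; rewrite (eq_bigr (fun e =>
      cdisc (X e) (y - p e * v) - cdisc (X e) (x - p e * v))); last first.
    move=> e _; rewrite -cdisc_window ?(ltnW xy) ?ltn_Fp //.
    by rewrite !natr_Zp.
  rewrite -(ler_int rat) expr2 2!intrM -expr2 rmorph_sum /= -!pmulrn.
  apply: le_trans Txy _; rewrite -sumrB ler_pM2l //.
  rewrite le_eqVlt; apply/orP; left; apply/eqP; congr (_ ^+ 2).
  by apply: eq_bigr => e _; rewrite intrB /H; ring.
case: (ltngtP u u') => [lt|lt|E].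
- exists v, (u : nat), (u' : nat); split; first by rewrite lt ltn_Fp.
  by apply: (window _ _ lt); rewrite -(sqrrN (T v u' - T v u)) opprB.
- exists v, (u' : nat), (u : nat); split; first by rewrite lt ltn_Fp.
  exact: window.
- by case/eqP: uu'; apply: val_inj.
Qed.
End ResidueDiscrepancy.

(** * Transfer to lists of natural numbers *)

Lemma list_sumE (T : Type) (f : T -> nat) s :
  list_sum (List.map f s) = (\sum_(x <- s) f x)%N.
Proof. by elim: s => [|x s IH] /=; rewrite ?big_nil // big_cons -IH. Qed.

Lemma modnE (x m : nat) : (0 < m)%N -> Nat.modulo x m = (x %% m)%N.
Proof.
move=> m0; apply/esym/(Nat.mod_unique _ _ (x %/ m)).
  by apply/ssrnat.ltP; rewrite ltn_mod.
by rewrite {1}(divn_eq x m) mulnC.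
Qed.

Lemma In_mem (T : eqType) (x : T) s : reflect (List.In x s) (x \in s).
Proof.
elim: s => [|y s IH] /=; first by constructor.
rewrite in_cons; apply: (iffP orP) => [[/eqP ->|/IH]|[->|/IH]].
- by left.
- by right.
- by left; exact/eqP.
- by right.
Qed.

Lemma NoDup_uniq (T : eqType) (s : seq T) : NoDup s -> uniq s.
Proof. by elim=> //= x l xl _ ->; rewrite andbT; apply/In_mem. Qed.

Delimit Scope Z_scope with coqZ.

(** An entry of [es] is the rotation speed of an edge together with the cells of its roots. [M] is
    fixed before [es] because both are residues modulo [M] and can be formed only once [M] is
    known. *)
Lemma large_discrepancy_mod_prime (m0 : nat) :
  exists M, (m0 < M)%coq_nat /\ forall es : list (nat * list nat),
    es <> nil -> NoDup (List.map fst es) ->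
    (forall e, List.In e es -> (fst e < M)%coq_nat /\
       (0 < length (snd e))%coq_nat /\ (length (snd e) < M)%coq_nat /\
       Forall (fun x => (x < M)%coq_nat) (snd e)) ->
    exists v a b, (a < b)%coq_nat /\ (b < M)%coq_nat /\
      let cnt := list_sum (List.map (fun e => length (List.filter
        (fun x => in_window M a b (x + fst e * v)%coq_nat) (snd e))) es) in
      let n := list_sum (List.map (fun e => length (snd e)) es) in
      let W := (Z.of_nat M * Z.of_nat cnt
                - Z.of_nat n * Z.of_nat (b - a)%coq_nat)%coqZ in
      (Z.of_nat (length es) * (Z.of_nat M * Z.of_nat M) <= 36 * (W * W))%coqZ.
Proof.
have [M Mm pM] := prime_above (maxn m0 2).
have M2 : (2 < M)%N by lia.
exists M; split; first by lia.
move=> es es0 es_nd esP.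
pose p (e : nat * list nat) : 'F_M := (e.1)%:R.
pose X (e : nat * list nat) : seq 'F_M := [seq x%:R | x <- e.2].
have szX e : size (X e) = size e.2 by rewrite size_map.
have := @rotated_discrepancy M pM M2 _ es p X.
case=> [||||v [a [b [ab]]]].
- by case: es es0 {es_nd esP}.
- by have /NoDup_uniq/map_uniq := es_nd.
- move=> e e' /In_mem ee /In_mem ee' pe.
  have [eM _] := esP _ ee; have [eM' _] := esP _ ee'.
  have E : e.1 = e'.1.
    have := congr1 (@nat_of_ord _) pe; rewrite !(val_Fp_nat pM) //; lia.
  move: es_nd ee ee'; elim: es {es0 esP pe} => //= x es IH nd.
  have [nin nd'] : ~ List.In x.1 (List.map fst es) /\ NoDup (List.map fst es) by inversion nd.
  have inm z : List.In z es -> List.In z.1 (List.map fst es) by apply: List.in_map.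
  case=> [xe|/[dup] /inm i1 i2]; case=> [xe'|/[dup] /inm i1' i2'].
  + by rewrite -xe -xe'.
  + by case: nin; rewrite xe E.
  + by case: nin; rewrite xe' -E.
  + exact: IH.
- by move=> e /In_mem ee; have [_ [H [H' _]]] := esP _ ee; rewrite szX -[size _]/(length _); lia.
move=> W; exists (v : nat), a, b; split; [by lia|split; first by lia].
move=> cnt n W'.
suff E : \sum_(e <- es)
     ((M * count (fun x : 'F_M => (a <= (x + p e * v)%R < b)%N) (X e))%N%:Z
       - (size (X e) * (b - a))%N%:Z) = M%:Z * cnt%:Z - n%:Z * (b - a)%N%:Z.
  move: W; rewrite {}E /W' -[length es]/(size es) expr2 -mulnn.
  move: (size es) cnt n {W'} => k c n; lia.
rewrite sumrB /cnt /n !list_sumE.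
rewrite -!(big_morph Posz PoszD (erefl 0%:Z)) -!PoszM.
rewrite big_distrr big_distrl /=; congr (Posz _ - Posz _); last first.
  by apply: eq_bigr => e _; rewrite szX.
rewrite big_seq [RHS]big_seq; apply: eq_bigr => e /In_mem ee; congr (_ * _)%N.
have [_ [_ [_ eF]]] := esP _ ee; rewrite /X count_map.
have cntE (f g : pred nat) s : (forall x, List.In x s -> f x = g x) ->
    count f s = length (List.filter g s).
  elim: s => //= x s IH fg; rewrite IH; last by move=> y ys; apply: fg; right.
  by rewrite fg; [case: (g x)|left].
apply: cntE => x xe.
have E : (x%:R + p e * v)%R = (x + e.1 * v)%:R :> 'F_M.
  by rewrite /p -{1}[v]natr_Zp -natrM -natrD.
rewrite -[LHS]/((a <= (x%:R + p e * v)%R < b)%N) E zmodp.val_Fp_nat //.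
rewrite /in_window modnE; last by lia.
move: (_ %% M)%N => y; by apply/idP/idP; lia.
Qed.

End Residues.

(** * Factorisation over the complex numbers *)
Module Factorization.

Import all_boot all_order all_algebra complex Rstruct zify.
Set Implicit Arguments. Unset Strict Implicit. Unset Printing Implicit Defensive.
Import Order.TTheory GRing.Theory Num.Theory.
Local Open Scope ring_scope.

Definition toC (z : Cx) : R[i] := Complex z.1 z.2.
Definition ofC (z : R[i]) : Cx := (complex.Re z, complex.Im z).

Lemma toCK : cancel toC ofC. Proof. by case. Qed.
Lemma ofCK : cancel ofC toC. Proof. by case. Qed.
Lemma toCM z w : toC (Cmul z w) = toC z * toC w. Proof. by []. Qed.
Lemma toCX z n : toC (Cpow z n) = toC z ^+ n.
Proof. by elim: n => [//|n IH]; rewrite exprS -IH. Qed.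
Lemma toC_sum n F : toC (Csum n F) = \sum_(i < n) toC (F i).
Proof. by elim: n => [|n IH]; rewrite ?big_ord0 // big_ord_recr -IH. Qed.
Lemma toC_prod z rs :
  toC (Cprod_lin z rs) = \prod_(r <- [seq toC r | r <- rs]) (toC z - r).
Proof. by elim: rs => [|r rs IH]; rewrite ?big_nil // big_cons -IH. Qed.

(** Division by [z^lo] leaves a polynomial of degree [hi - lo] with constant term [c lo]. It splits
    over the algebraically closed field [R[i]], and its roots are nonzero because its constant term
    is. *)
Lemma Csum_factor (c : nat -> Cx) (lo hi D : nat) :
  (lo <= hi)%coq_nat -> (hi < D)%coq_nat -> c lo <> C0 -> c hi <> C0 ->
  (forall i, (i < lo)%coq_nat \/ (hi < i)%coq_nat -> c i = C0) ->
  exists rs, length rs = (hi - lo)%coq_nat /\ Forall (fun r => r <> C0) rs /\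
    forall z, Csum D (fun i => Cmul (c i) (Cpow z i)) =
      Cmul (c hi) (Cmul (Cpow z lo) (Cprod_lin z rs)).
Proof.
move=> /ssrnat.leP lohi /ssrnat.ltP hiD clo chi c0.
pose p := \poly_(i < (hi - lo).+1) toC (c (lo + i)%N).
have toC_eq0 z : toC z = 0 -> z = C0 by move=> /(congr1 ofC); rewrite toCK.
have psz : size p = (hi - lo).+1.
  rewrite size_poly_eq //= subnKC //.
  by apply/eqP => /toC_eq0.
have lcp : lead_coef p = toC (c hi).
  by rewrite lead_coefE psz /= coef_poly ltnSn subnKC.
have [rs prs] := closed_field_poly_normal p.
have szrs : size rs = (hi - lo)%N.
  move: psz; rewrite prs size_scale ?size_prod_XsubC => [[]//|].
  by rewrite lcp; apply/eqP => /toC_eq0.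
have p0 : p.[0] != 0.
  rewrite horner_coef0 coef_poly /= addn0.
  by apply/eqP => /toC_eq0.
exists [seq ofC r | r <- rs]; split; first by rewrite -[LHS]/(size _) size_map szrs.
split.
  have : all (fun r => r != 0) rs.
    apply/allP => r rin; apply: contraNneq p0 => r0; rewrite -{1}r0.
    have /rootP pr0 : root (\prod_(z <- rs) ('X - z%:P)) r by rewrite root_prod_XsubC.
    by rewrite prs hornerZ pr0 mulr0.
  elim: rs {prs szrs} => [|r rs IH] /= => [_|/andP[r0 /IH rsP]]; constructor => //.
  by move=> /(congr1 toC); rewrite ofCK => /eqP; rewrite (negPf r0).
move=> z; apply: (can_inj toCK); rewrite !toCM toCX toC_prod -map_comp.
rewrite (eq_map (g := id)) ?map_id; last exact: ofCK.
have -> : \prod_(r <- rs) (toC z - r) = (\prod_(r <- rs) ('X - r%:P)).[toC z].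
  by rewrite horner_prod; apply: eq_bigr => r _; rewrite hornerXsubC.
rewrite mulrCA -lcp -hornerZ -prs horner_poly toC_sum.
rewrite -(big_mkord xpredT (fun i => toC (Cmul (c i) (Cpow z i)))).
rewrite (big_cat_nat (n := lo)) //=; last by lia.
rewrite (big_cat_nat (n := hi.+1) (m := lo)) //=; last by lia.
rewrite big_nat big1 ?add0r; last first.
  by move=> i /andP[_ /ssrnat.ltP ilo]; rewrite toCM c0 ?mul0r //; left.
rewrite [X in _ + X]big_nat [X in _ + X]big1 ?addr0; last first.
  by move=> i /andP[/ssrnat.ltP ilo _]; rewrite toCM c0 ?mul0r //; right.
rewrite -{1}[lo]add0n big_addn -subSn // big_mkord mulr_sumr; apply: eq_bigr => i _.
by rewrite toCM toCX addnC exprD mulrCA.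
Qed.

End Factorization.

(** * Limits and continuity of roots *)

Lemma Cx_field_theory : field_theory C0 C1 Cadd Cmul Csub Copp Cdiv Cinv eq.
Proof. exact C_field_theory. Qed.
Add Field Cx_field : Cx_field_theory.

Lemma Cmod_Coquelicot z : Cmod z = Complex.Cmod z.
Proof. unfold Cmod, Complex.Cmod. f_equal. ring. Qed.

Lemma Cmod_mul z w : Cmod (Cmul z w) = Cmod z * Cmod w.
Proof. rewrite !Cmod_Coquelicot. apply Cmod_mult. Qed.

Lemma Cmod_triangle_sub x y z : Cmod (Csub x z) <= Cmod (Csub x y) + Cmod (Csub y z).
Proof.
  rewrite !Cmod_Coquelicot.
  replace (Csub x z) with (Cplus (Csub x y) (Csub y z)).
  - apply Cmod_triangle.
  - change (Cadd (Csub x y) (Csub y z) = Csub x z). ring.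
Qed.

Lemma Cmod_sub_sym x y : Cmod (Csub x y) = Cmod (Csub y x).
Proof. unfold Cmod, Csub; simpl. f_equal. ring. Qed.

Lemma Cmod_nonneg z : 0 <= Cmod z.
Proof. apply sqrt_pos. Qed.

Lemma Cmod_pos z : z <> C0 -> 0 < Cmod z.
Proof. rewrite Cmod_Coquelicot. apply Cmod_gt_0. Qed.

Lemma Cmod_C0 : Cmod C0 = 0.
Proof. rewrite Cmod_Coquelicot. apply Cmod_0. Qed.

Lemma Csub_neq0 z w : z <> w -> Csub z w <> C0.
Proof. intros H E. apply H. replace z with (Cadd (Csub z w) w) by ring. rewrite E. ring. Qed.

Lemma Cmul_neq0 z w : z <> C0 -> w <> C0 -> Cmul z w <> C0.
Proof. exact (Cmult_neq_0 z w). Qed.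

Lemma C1_neq0 : C1 <> C0.
Proof. intros H. apply (f_equal fst) in H. simpl in H. lra. Qed.

Definition Clim (b : nat -> Cx) (l : Cx) : Prop :=
  is_lim_seq (fun n => fst (b n)) (fst l) /\ is_lim_seq (fun n => snd (b n)) (snd l).

Lemma Clim_const z : Clim (fun _ => z) z.
Proof. split; apply is_lim_seq_const. Qed.

Lemma Clim_ext_loc b b' l : eventually (fun n => b n = b' n) -> Clim b l -> Clim b' l.
Proof.
  intros E [H1 H2]. split.
  - apply is_lim_seq_ext_loc with (2 := H1).
    revert E. apply filter_imp. now intros n ->.
  - apply is_lim_seq_ext_loc with (2 := H2).
    revert E. apply filter_imp. now intros n ->.
Qed.

Lemma Clim_add b b' l l' : Clim b l -> Clim b' l' -> Clim (fun n => Cadd (b n) (b' n)) (Cadd l l').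
Proof. intros [H1 H2] [H3 H4]. split; simpl; now apply is_lim_seq_plus'. Qed.

Lemma Clim_sub b b' l l' : Clim b l -> Clim b' l' -> Clim (fun n => Csub (b n) (b' n)) (Csub l l').
Proof. intros [H1 H2] [H3 H4]. split; simpl; now apply is_lim_seq_minus'. Qed.

Lemma Clim_mul b b' l l' : Clim b l -> Clim b' l' -> Clim (fun n => Cmul (b n) (b' n)) (Cmul l l').
Proof.
  intros [H1 H2] [H3 H4]. split; simpl.
  - apply is_lim_seq_minus'; now apply is_lim_seq_mult'.
  - apply is_lim_seq_plus'; now apply is_lim_seq_mult'.
Qed.

Lemma Clim_sum N (F : nat -> nat -> Cx) l :
  (forall i, (i < N)%nat -> Clim (fun n => F n i) (l i)) ->
  Clim (fun n => Csum N (F n)) (Csum N l).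
Proof.
  induction N as [|N IH]; simpl; intros H.
  - apply Clim_const.
  - apply Clim_add; [apply IH; intros; apply H; lia | apply H; lia].
Qed.

Lemma Clim_mod b l : Clim b l -> is_lim_seq (fun n => Cmod (b n)) (Cmod l).
Proof.
  intros [H1 H2]. unfold Cmod.
  apply (is_lim_seq_continuous sqrt
           (fun n => fst (b n) * fst (b n) + snd (b n) * snd (b n))).
  - apply continuity_pt_sqrt. nra.
  - apply is_lim_seq_plus'; now apply is_lim_seq_mult'.
Qed.

Lemma Clim_dist b l :
  (forall eps, 0 < eps -> eventually (fun n => Cmod (Csub (b n) l) < eps)) -> Clim b l.
Proof.
  intros H.
  assert (K : forall z, Rabs (fst z) <= Cmod z /\ Rabs (snd z) <= Cmod z).
  { intros z. rewrite Cmod_Coquelicot. pose proof (Rmax_Cmod z).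
    pose proof (Rmax_l (Rabs (fst z)) (Rabs (snd z))).
    pose proof (Rmax_r (Rabs (fst z)) (Rabs (snd z))). lra. }
  split; apply is_lim_seq_spec; intros eps;
    generalize (H eps (cond_pos eps)); apply filter_imp; intros n Hn;
    destruct (K (Csub (b n) l)) as [K1 K2]; simpl in K1, K2; lra.
Qed.

Lemma Clim_inv b l : l <> C0 -> Clim b l -> Clim (fun n => Cinv (b n)) (Cinv l).
Proof.
  intros Hl [H1 H2].
  assert (Hd : fst l ^ 2 + snd l ^ 2 <> 0).
  { intros E. apply Hl. destruct l as [x y]; simpl in *.
    unfold C0. f_equal; nra. }
  assert (L : is_lim_seq (fun n => fst (b n) ^ 2 + snd (b n) ^ 2) (fst l ^ 2 + snd l ^ 2)).
  { apply is_lim_seq_plus'; simpl.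
    - apply is_lim_seq_mult'; [|apply is_lim_seq_mult'; [|apply is_lim_seq_const]]; assumption.
    - apply is_lim_seq_mult'; [|apply is_lim_seq_mult'; [|apply is_lim_seq_const]]; assumption. }
  unfold Cinv. split; simpl fst; simpl snd.
  - apply is_lim_seq_div'; assumption.
  - apply is_lim_seq_div'; try assumption.
    now apply (is_lim_seq_opp (fun n => snd (b n)) (snd l)).
Qed.

Lemma Clim_eventually_neq0 b l : Clim b l -> l <> C0 -> eventually (fun n => b n <> C0).
Proof.
  intros H Hl. pose proof (Cmod_pos l Hl) as Hp.
  apply Clim_mod in H. apply is_lim_seq_spec in H.
  generalize (H (mkposreal _ Hp)). apply filter_imp. intros n Hn E.
  rewrite E, Cmod_C0 in Hn. simpl in Hn.
  rewrite Rabs_left in Hn; lra.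
Qed.

(** * Products of linear factors and the convergence of their roots *)

Lemma Cprod_lin_app z l l' : Cprod_lin z (l ++ l') = Cmul (Cprod_lin z l) (Cprod_lin z l').
Proof.
  induction l as [|r l IH]; simpl.
  - ring.
  - unfold Cprod_lin in *. simpl. rewrite IH. ring.
Qed.

Lemma Cprod_lin_cons z r l : Cprod_lin z (r :: l) = Cmul (Csub z r) (Cprod_lin z l).
Proof. reflexivity. Qed.

Lemma Cprod_lin_perm z l l' : Permutation l l' -> Cprod_lin z l = Cprod_lin z l'.
Proof.
  induction 1; rewrite ?Cprod_lin_cons.
  - reflexivity.
  - now rewrite IHPermutation.
  - ring.
  - congruence.
Qed.

Lemma Cprod_lin_neq0 z l : ~ In z l -> Cprod_lin z l <> C0.
Proof.
  induction l as [|r l IH]; intros H.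
  - apply C1_neq0.
  - rewrite Cprod_lin_cons. apply Cmul_neq0.
    + apply Csub_neq0. intros ->. apply H. now left.
    + apply IH. intros K. apply H. now right.
Qed.

Lemma Cprod_lin_scale k k' z l : Cmul k k' = C1 ->
  Cprod_lin (Cmul k z) l = Cmul (Cpow k (length l)) (Cprod_lin z (map (Cmul k') l)).
Proof.
  intros H. induction l as [|r l IH].
  - simpl. unfold Cprod_lin; simpl. ring.
  - simpl map. simpl length. simpl Cpow. rewrite !Cprod_lin_cons, IH.
    replace (Csub (Cmul k z) r) with (Cmul k (Csub z (Cmul k' r))).
    + ring.
    + transitivity (Csub (Cmul k z) (Cmul (Cmul k k') r)); [ring|]. rewrite H. ring.
Qed.

Lemma Cpow_prod_lin z n : Cpow z n = Cprod_lin z (repeat C0 n).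
Proof.
  induction n as [|n IH]; [reflexivity|].
  simpl repeat. rewrite Cprod_lin_cons, <- IH. simpl. ring.
Qed.

(* Comparing the two products factor by factor: each [r] is at distance
   at least [3 eps / 4] from [x0], and [x0], [x1] are within [eps / 2]. *)
Lemma Cprod_lin_far_roots z0 x0 x1 eps l N : (length l <= N)%nat ->
  Forall (fun r => eps <= Cmod (Csub r z0)) l ->
  4 * Cmod (Csub x0 z0) <= eps -> 4 * Cmod (Csub x1 z0) <= eps ->
  Cmod (Cprod_lin x1 l) <= 2 ^ N * Cmod (Cprod_lin x0 l).
Proof.
  revert N. induction l as [|r l IH]; intros N HN HF H0 H1.
  - assert (1 <= 2 ^ N) by (apply pow_R1_Rle; lra).
    pose proof (Cmod_nonneg (Cprod_lin x0 nil)).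
    change (Cprod_lin x1 nil) with (Cprod_lin x0 nil). nra.
  - destruct N as [|N]; [simpl in HN; lia|]. simpl in HN.
    inversion HF as [|? ? Hr HF']; subst.
    rewrite !Cprod_lin_cons, !Cmod_mul.
    specialize (IH N ltac:(lia) HF' H0 H1).
    pose proof (Cmod_triangle_sub r x0 z0) as T1.
    pose proof (Cmod_triangle_sub x1 x0 r) as T2.
    pose proof (Cmod_triangle_sub x1 z0 x0) as T3.
    rewrite (Cmod_sub_sym z0 x0) in T3. rewrite (Cmod_sub_sym r x0) in T1.
    pose proof (Cmod_nonneg (Cprod_lin x1 l)). pose proof (Cmod_nonneg (Csub x1 r)).
    pose proof (Cmod_nonneg (Csub x0 r)).
    assert (Cmod (Csub x1 r) <= 2 * Cmod (Csub x0 r)) by lra.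
    simpl pow.
    apply Rle_trans with ((2 * Cmod (Csub x0 r)) * (2 ^ N * Cmod (Cprod_lin x0 l))).
    + apply Rmult_le_compat; assumption.
    + right; ring.
Qed.

(** The numbers [eps / (m + 2)] are pairwise distinct, so [X] cannot contain [length X + 1] of
    them. *)
Lemma exists_small_avoiding eps (X : list R) : 0 < eps ->
  exists d, 0 < d < eps /\ ~ In d X.
Proof.
  intros He. pose (f := fun m => eps / (INR m + 2)).
  assert (Hf : forall m, 0 < f m < eps).
  { intros m. pose proof (pos_INR m). unfold f. split.
    - apply Rdiv_lt_0_compat; lra.
    - apply Rmult_lt_reg_r with (INR m + 2); [lra|].
      unfold Rdiv. rewrite Rmult_assoc, Rinv_l; nra. }
  apply NNPP. intros Hno.
  assert (Hincl : incl (map f (seq 0 (S (length X)))) X).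
  { intros x Hx. apply in_map_iff in Hx. destruct Hx as [m [<- _]].
    apply NNPP. intros Hn. apply Hno. exists (f m). split; [apply Hf | assumption]. }
  apply NoDup_incl_length in Hincl.
  - rewrite length_map, length_seq in Hincl. lia.
  - apply FinFun.Injective_map_NoDup; [|apply seq_NoDup].
    intros m m' E. unfold f, Rdiv in E.
    apply Rmult_eq_reg_l in E; [|lra]. apply Rinv_eq_reg in E.
    apply INR_eq. lra.
Qed.

Lemma exists_near_avoiding z0 eps (X : list Cx) : 0 < eps ->
  exists x, Cmod (Csub x z0) < eps /\ ~ In x X.
Proof.
  intros He.
  destruct (exists_small_avoiding eps (map (fun x => fst x - fst z0) X) He) as [d [Hd Nd]].
  exists (Cadd z0 (d, 0)). split.
  - replace (Csub (Cadd z0 (d, 0)) z0) with ((d, 0) : Cx) by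
      (unfold Csub, Cadd; simpl; f_equal; ring).
    unfold Cmod; simpl. rewrite Rmult_0_l, Rplus_0_r, sqrt_square; lra.
  - intros Hin. apply Nd. apply in_map_iff. exists (Cadd z0 (d, 0)).
    split; [simpl; ring | assumption].
Qed.

Lemma Permutation_length_filter {A} (f : A -> bool) l l' :
  Permutation l l' -> length (filter f l) = length (filter f l').
Proof.
  induction 1; simpl; try congruence.
  - destruct (f x); simpl; congruence.
  - destruct (f x), (f y); reflexivity.
Qed.

Lemma nearest_root z0 (L : list Cx) : L <> nil ->
  exists r L', Permutation L (r :: L') /\
    forall x, In x L -> Cmod (Csub r z0) <= Cmod (Csub x z0).
Proof.
  induction L as [|x L IH]; [now intros []|]. intros _.
  destruct L as [|y L].
  - exists x, nil. split; [reflexivity|]. intros w [<-|[]]. lra.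
  - destruct IH as [r [L' [HP Hr]]]; [discriminate|].
    destruct (Rle_lt_dec (Cmod (Csub r z0)) (Cmod (Csub x z0))) as [H|H].
    + exists r, (x :: L'). split.
      * rewrite HP. apply perm_swap.
      * intros w [<-|Hw]; [assumption|]. now apply Hr.
    + exists x, (y :: L). split; [reflexivity|].
      intros w [<-|Hw]; [lra|]. specialize (Hr w Hw). lra.
Qed.

Lemma Cprod_lin_bounded z0 l :
  exists B, 0 < B /\ forall x, Cmod (Csub x z0) < 1 -> Cmod (Cprod_lin x l) <= B.
Proof.
  induction l as [|r l [B [HB H]]].
  - exists 1. split; [lra|]. intros x _.
    change (Cprod_lin x nil) with C1. unfold Cmod, C1; simpl.
    replace (1 * 1 + 0 * 0) with 1 by ring. rewrite sqrt_1. lra.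
  - exists ((1 + Cmod (Csub z0 r)) * B). pose proof (Cmod_nonneg (Csub z0 r)).
    split; [nra|]. intros x Hx. rewrite Cprod_lin_cons, Cmod_mul.
    apply Rmult_le_compat; try apply Cmod_nonneg.
    + pose proof (Cmod_triangle_sub x z0 r). lra.
    + now apply H.
Qed.

(** If all roots in [L n] stayed [eps] away from [z0], the values at two points near [z0] would
    agree up to the factor [2 ^ N]. But in the limit the value at [x1] is a fixed nonzero number,
    while the value at [x0] is as small as desired when [x0] tends to [z0]. The finite set [X] of
    excluded points is there for the induction that follows, where dividing out a root destroys
    convergence at that root. *)
Lemma limit_root_approached z0 l X kap (c : nat -> Cx) (L : nat -> list Cx) N :
  kap <> C0 -> (forall n, (length (L n) <= N)%nat) ->
  (forall z, ~ In z X ->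
     Clim (fun n => Cmul (c n) (Cprod_lin z (L n))) (Cmul kap (Cprod_lin z (z0 :: l)))) ->
  forall eps, 0 < eps ->
    eventually (fun n => exists r, In r (L n) /\ Cmod (Csub r z0) < eps).
Proof.
  intros Hk HN HL eps He.
  destruct (exists_near_avoiding z0 (eps / 4) (X ++ z0 :: l)) as [x1 [Hx1 Nx1]]; [lra|].
  assert (HA : 0 < Cmod (Cmul kap (Cprod_lin x1 (z0 :: l)))).
  { apply Cmod_pos, Cmul_neq0; [assumption|]. apply Cprod_lin_neq0.
    intros K. apply Nx1, in_or_app. now right. }
  set (A := Cmod _) in HA.
  destruct (Cprod_lin_bounded z0 l) as [B [HB HBx]].
  pose proof (Cmod_pos kap Hk) as Hkp.
  assert (H2 : 0 < 2 ^ N) by (apply pow_lt; lra).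
  (* The three bounds serve [Cprod_lin_far_roots], the bound [B] on the unit disc around [z0], and
     the comparison of [2 ^ N] times the limit at [x0] with the limit [A] at [x1]. *)
  set (d := Rmin (eps / 4) (Rmin 1 (A / (2 ^ N * (Cmod kap * B))))).
  assert (Hpos : 0 < 2 ^ N * (Cmod kap * B)) by (apply Rmult_lt_0_compat; nra).
  assert (Hd : 0 < d).
  { unfold d. repeat apply Rmin_glb_lt; try lra. now apply Rdiv_lt_0_compat. }
  destruct (exists_near_avoiding z0 d X Hd) as [x0 [Hx0 Nx0]].
  assert (Hd1 : d <= eps / 4) by apply Rmin_l.
  assert (Hd2 : d <= 1) by (eapply Rle_trans; [apply Rmin_r | apply Rmin_l]).
  assert (Hd3 : d <= A / (2 ^ N * (Cmod kap * B))) by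
    (eapply Rle_trans; [apply Rmin_r | apply Rmin_r]).
  assert (HA0 : 2 ^ N * Cmod (Cmul kap (Cprod_lin x0 (z0 :: l))) < A).
  { rewrite Cprod_lin_cons, !Cmod_mul.
    specialize (HBx x0 ltac:(lra)).
    assert (K : Cmod (Csub x0 z0) * (2 ^ N * (Cmod kap * B)) < A).
    { apply Rmult_lt_reg_r with (/ (2 ^ N * (Cmod kap * B))).
      - now apply Rinv_0_lt_compat.
      - rewrite Rmult_assoc, Rinv_r; [unfold Rdiv in Hd3; lra | lra]. }
    apply Rle_lt_trans with (2 := K).
    pose proof (Cmod_nonneg (Csub x0 z0)).
    replace (2 ^ N * (Cmod kap * (Cmod (Csub x0 z0) * Cmod (Cprod_lin x0 l)))) with
      (Cmod (Csub x0 z0) * (2 ^ N * (Cmod kap * Cmod (Cprod_lin x0 l)))) by ring.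
    apply Rmult_le_compat_l; [assumption|]. apply Rmult_le_compat_l; [lra|].
    apply Rmult_le_compat_l; lra. }
  assert (L1 := Clim_mod _ _ (HL x1 (fun K => Nx1 (in_or_app _ _ _ (or_introl K))))).
  assert (L0 := Clim_mod _ _ (HL x0 Nx0)).
  assert (LD := is_lim_seq_minus' _ _ _ _ L1
                  (is_lim_seq_mult' _ _ _ _ (is_lim_seq_const (2 ^ N)) L0)).
  apply is_lim_seq_spec in LD. fold A in LD.
  assert (Hgap : 0 < A - 2 ^ N * Cmod (Cmul kap (Cprod_lin x0 (z0 :: l)))) by lra.
  generalize (LD (mkposreal _ Hgap)). apply filter_imp. intros n Hn.
  simpl in Hn. apply Rabs_def2 in Hn. destruct Hn as [_ Hn].
  apply NNPP. intros Hno.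
  assert (HF : Forall (fun r => eps <= Cmod (Csub r z0)) (L n)).
  { apply Forall_forall. intros r Hr. apply Rnot_lt_le. intros K.
    apply Hno. now exists r. }
  assert (HC := Cprod_lin_far_roots z0 x0 x1 eps (L n) N (HN n) HF ltac:(lra) ltac:(lra)).
  rewrite !Cmod_mul in Hn. pose proof (Cmod_nonneg (c n)).
  assert (Cmod (c n) * Cmod (Cprod_lin x1 (L n)) <=
          Cmod (c n) * (2 ^ N * Cmod (Cprod_lin x0 (L n)))) by
    (apply Rmult_le_compat_l; assumption).
  lra.
Qed.

(** Induction on [Z], which takes multiplicities into account. The root of [L n] nearest to [z0]
    tends to [z0], hence ends up in [U]; dividing it out leaves products that converge to the
    remaining product at every [z] other than [z0] and the points of [X]. [W] collects limit roots
    that are not to be counted. *)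
Lemma limit_roots_lower_bound (U : Cx -> bool) Z :
  forall W X kap (c : nat -> Cx) (L : nat -> list Cx) N,
  kap <> C0 -> (forall n, (length (L n) <= N)%nat) ->
  (forall z, ~ In z X ->
     Clim (fun n => Cmul (c n) (Cprod_lin z (L n))) (Cmul kap (Cprod_lin z (Z ++ W)))) ->
  Forall (fun z => exists eps, 0 < eps /\
                    forall w, Cmod (Csub w z) < eps -> U w = true) Z ->
  eventually (fun n => (length Z <= length (filter U (L n)))%nat).
Proof.
  induction Z as [|z0 Z IH]; intros W X kap c L N Hk HN HL HU.
  - exists O. intros. simpl. lia.
  - inversion HU as [|? ? [eps [He HUe]] HU']; subst.
    assert (Near := limit_root_approached z0 (Z ++ W) X kap c L N Hk HN HL).
    assert (Hch : forall n, exists p : Cx * list Cx, L n <> nil ->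
       Permutation (L n) (fst p :: snd p) /\
       forall x, In x (L n) -> Cmod (Csub (fst p) z0) <= Cmod (Csub x z0)).
    { intros n. destruct (excluded_middle_informative (L n = nil)) as [E|E].
      - exists (z0, nil). now intros [].
      - destruct (nearest_root z0 (L n) E) as [r [L' H]]. now exists (r, L'). }
    set (P := fun n => proj1_sig (constructive_indefinite_description _ (Hch n))).
    assert (HP : forall n, L n <> nil -> Permutation (L n) (fst (P n) :: snd (P n)) /\
       forall x, In x (L n) -> Cmod (Csub (fst (P n)) z0) <= Cmod (Csub x z0))
      by (intros n; exact (proj2_sig (constructive_indefinite_description _ (Hch n)))).
    clearbody P.
    assert (Hr : forall e, 0 < e -> eventually (fun n =>
        Cmod (Csub (fst (P n)) z0) < e /\ Permutation (L n) (fst (P n) :: snd (P n)))).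
    { intros e Hpe. generalize (Near e Hpe). apply filter_imp. intros n [r [Hin Hlt]].
      assert (Hne : L n <> nil) by (intros E; rewrite E in Hin; destruct Hin).
      destruct (HP n Hne) as [HPn Hmin]. split; [|assumption].
      specialize (Hmin r Hin). lra. }
    assert (Lr : Clim (fun n => fst (P n)) z0).
    { apply Clim_dist. intros e Hpe. generalize (Hr e Hpe). apply filter_imp. tauto. }
    (* For small [n] the list [L n] may be empty and [snd (P n)] arbitrary; the default [nil] keeps
       the length bound valid for every [n]. *)
    set (L' := fun n => if Nat.leb (length (snd (P n))) N then snd (P n) else nil).
    assert (HL' : eventually (fun n => L' n = snd (P n))).
    { generalize (Hr 1 Rlt_0_1). apply filter_imp. intros n [_ Hp].
      apply Permutation_length in Hp. specialize (HN n). unfold L'. simpl in Hp.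
      replace (Nat.leb (length (snd (P n))) N) with true; [reflexivity|].
      symmetry. apply Nat.leb_le. lia. }
    assert (Main := IH W (z0 :: X) kap c L' N Hk).
    assert (E : eventually (fun n => (length Z <= length (filter U (L' n)))%nat)).
    { apply Main; [| |assumption].
      - intros n. unfold L'. destruct (Nat.leb (length (snd (P n))) N) eqn:E; [|simpl; lia].
        now apply Nat.leb_le.
      - intros z Hz.
        assert (Hz0 : Csub z z0 <> C0) by (apply Csub_neq0; intros ->; apply Hz; now left).
        replace (Cmul kap (Cprod_lin z (Z ++ W))) with
          (Cmul (Cmul kap (Cprod_lin z ((z0 :: Z) ++ W))) (Cinv (Csub z z0))).
        2: { simpl app. rewrite Cprod_lin_cons. field. exact Hz0. }
        assert (LS : Clim (fun n => Csub z (fst (P n))) (Csub z z0))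
          by (apply Clim_sub; [apply Clim_const | assumption]).
        eapply Clim_ext_loc.
        2: { apply Clim_mul; [apply HL; intros K; apply Hz; now right |].
             apply Clim_inv; [exact Hz0 | exact LS]. }
        generalize (filter_and _ _ (filter_and _ _ (Hr 1 Rlt_0_1) HL')
                     (Clim_eventually_neq0 _ _ LS Hz0)).
        apply filter_imp. intros n [[[_ Hp] ->] Hne].
        rewrite (Cprod_lin_perm z _ _ Hp), Cprod_lin_cons. field. exact Hne. }
    generalize (filter_and _ _ (filter_and _ _ (Hr eps He) HL') E).
    apply filter_imp. intros n [[[Hd Hp] EL] Hlen].
    rewrite (Permutation_length_filter U _ _ Hp). simpl. rewrite (HUe _ Hd).
    rewrite EL in Hlen. simpl. lia.
Qed.

Lemma filter_partition_perm {A} (f : A -> bool) l :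
  Permutation (filter f l ++ filter (fun x => negb (f x)) l) l.
Proof.
  induction l as [|x l IH]; simpl; [constructor|].
  destruct (f x); simpl.
  - now constructor.
  - rewrite <- Permutation_middle. now constructor.
Qed.

(** Equality cannot be expected: a limit root on the boundary of [U] may be approached from inside.
    [L n] may also be longer than [Z], since roots may go to infinity while [c n] compensates. *)
Lemma root_count_semicontinuous (U : Cx -> bool) Z kap (c : nat -> Cx) (L : nat -> list Cx) N :
  (forall z, U z = true -> exists eps, 0 < eps /\
     forall w, Cmod (Csub w z) < eps -> U w = true) ->
  kap <> C0 -> (forall n, (length (L n) <= N)%nat) ->
  (forall z, Clim (fun n => Cmul (c n) (Cprod_lin z (L n))) (Cmul kap (Cprod_lin z Z))) ->
  eventually (fun n => (length (filter U Z) <= length (filter U (L n)))%nat).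
Proof.
  intros HU Hk HN HL.
  apply (limit_roots_lower_bound U (filter U Z) (filter (fun x => negb (U x)) Z) nil kap c L N);
    try assumption.
  - intros z _. rewrite (Cprod_lin_perm z _ _ (filter_partition_perm U Z)). apply HL.
  - apply Forall_forall. intros z Hz. apply filter_In in Hz. now apply HU.
Qed.
(** * Lower hulls *)

Definition edge := ((nat * nat) * (nat * nat))%type.
Definition slope (e : edge) : R :=
  (INR (snd (snd e)) - INR (snd (fst e))) / (INR (fst (snd e)) - INR (fst (fst e))).
Definition height (e : edge) : R := INR (snd (fst e)) - slope e * INR (fst (fst e)).
Definition width (e : edge) : nat := fst (snd e) - fst (fst e).

(** The last clause makes the edge maximal on its line. The edge polynomial then has its lowest and
    highest exponents exactly at the two ends, hence exactly [width e] nonzero roots. *)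
Definition lower_edge (P : nat * nat -> Prop) (e : edge) : Prop :=
  P (fst e) /\ P (snd e) /\ (fst (fst e) < fst (snd e))%nat /\
  forall q, P q ->
    height e <= INR (snd q) - slope e * INR (fst q) /\
    (INR (snd q) - slope e * INR (fst q) = height e ->
     (fst (fst e) <= fst q <= fst (snd e))%nat).

(** It is the segment that lies below: [q] is on it or above it. Equal ends are allowed and serve
    the points straight above the last vertex. *)
Definition below_segment (v v' q : nat * nat) : Prop :=
  exists t, 0 <= t <= 1 /\
    INR (fst q) = (1 - t) * INR (fst v) + t * INR (fst v') /\
    (1 - t) * INR (snd v) + t * INR (snd v') <= INR (snd q).

Definition box (P : nat * nat -> Prop) (D : nat) : Prop :=
  forall q, P q -> (fst q < D)%nat /\ (snd q < D)%nat.

Lemma finite_argmin (P : nat * nat -> Prop) D (f : nat * nat -> R) :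
  box P D -> (exists q, P q) -> exists q, P q /\ forall q', P q' -> f q <= f q'.
Proof.
  intros HS [q0 H0].
  assert (K : forall l : list (nat * nat), (exists q, In q l /\ P q) ->
     exists q, P q /\ forall q', In q' l -> P q' -> f q <= f q').
  { induction l as [|x l IH]; intros [q [Hin Hq]]; [destruct Hin|].
    destruct (excluded_middle_informative (exists q, In q l /\ P q)) as [E|E].
    - destruct (IH E) as [r [Hr Hmin]].
      destruct (excluded_middle_informative (P x /\ f x < f r)) as [[Hx Hlt]|Hx].
      + exists x. split; [assumption|]. intros q' [<-|Hq'] HS'; [lra|].
        specialize (Hmin q' Hq' HS'). lra.
      + exists r. split; [assumption|]. intros q' [<-|Hq'] HS'; [|now apply Hmin].
        apply Rnot_lt_le. intros Hlt. now apply Hx.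
    - destruct Hin as [<-|Hin]; [|destruct E; now exists q].
      exists x. split; [assumption|]. intros q' [<-|Hq'] HS'; [lra|].
      destruct E. now exists q'. }
  destruct (K (list_prod (seq 0 D) (seq 0 D))) as [q [Hq Hmin]].
  - exists q0. split; [|assumption]. destruct (HS _ H0). destruct q0.
    apply in_prod; apply in_seq; simpl in *; lia.
  - exists q. split; [assumption|]. intros q' Hq'. apply Hmin; [|assumption].
    destruct (HS _ Hq'). destruct q'. apply in_prod; apply in_seq; simpl in *; lia.
Qed.

(** The invariant of gift wrapping: a supporting line of slope [m] whose rightmost contact is [v].
    Strictness to the right forces the next slope to exceed [m], which is why the slopes along the
    chain are distinct. *)
Definition supports (P : nat * nat -> Prop) (v : nat * nat) (m : R) : Prop :=
  P v /\ forall q, P q ->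
    INR (snd v) + m * (INR (fst q) - INR (fst v)) <= INR (snd q) /\
    ((fst v < fst q)%nat -> INR (snd v) + m * (INR (fst q) - INR (fst v)) < INR (snd q)).

(** The next vertex minimises the slope seen from [v] and, among ties, is farthest to the right; the
    tie-break yields maximality of the edge and strictness beyond [v']. To the left of [v] the new
    line, being steeper, runs below the old one. *)
Lemma gift_wrap_step P D v m : box P D -> supports P v m ->
  (exists q, P q /\ (fst v < fst q)%nat) ->
  exists v', m < slope (v, v') /\ lower_edge P (v, v') /\ supports P v' (slope (v, v')).
Proof.
  intros HS [Hv Hm] [q0 Hq0].
  pose (S1 := fun q => P q /\ (fst v < fst q)%nat).
  destruct (finite_argmin S1 D (fun q => slope (v, q))) as [q1 [H1 Hmin1]].
  { intros q [Hq _]. now apply HS. }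
  { now exists q0. }
  pose (S2 := fun q => S1 q /\ slope (v, q) = slope (v, q1)).
  destruct (finite_argmin S2 D (fun q => - INR (fst q))) as [v' [[H2 E2] Hmin2]].
  { intros q [[Hq _] _]. now apply HS. }
  { now exists q1. }
  exists v'.
  assert (Hdiv : forall q, (fst v < fst q)%nat ->
     INR (snd q) = INR (snd v) + slope (v, q) * (INR (fst q) - INR (fst v))).
  { intros q Hq. apply lt_INR in Hq. unfold slope; simpl. field. lra. }
  destruct H2 as [Hv' Hlt]. pose proof (lt_INR _ _ Hlt) as HltR.
  pose proof (Hdiv v' Hlt) as Ev'.
  set (s := slope (v, v')) in *.
  assert (Hms : m < s).
  { destruct (Hm v' Hv') as [_ K]. specialize (K Hlt). nra. }
  assert (Hright : forall q, P q -> (fst v < fst q)%nat ->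
     INR (snd v) + s * (INR (fst q) - INR (fst v)) <= INR (snd q) /\
     ((fst v' < fst q)%nat ->
      INR (snd v) + s * (INR (fst q) - INR (fst v)) < INR (snd q))).
  { intros q Hq Hvq. pose proof (lt_INR _ _ Hvq).
    assert (Hle : s <= slope (v, q)) by (rewrite E2; apply Hmin1; now split).
    rewrite (Hdiv q Hvq). split; [nra|]. intros Hq'.
    destruct (Req_dec s (slope (v, q))) as [E|E]; [|nra].
    exfalso. specialize (Hmin2 q).
    apply lt_INR in Hq'.
    assert (- INR (fst v') <= - INR (fst q)); [|lra].
    apply Hmin2. split; [now split|]. congruence. }
  assert (Hleft : forall q, P q -> (fst q <= fst v)%nat ->
     INR (snd v) + s * (INR (fst q) - INR (fst v)) <= INR (snd q) /\
     ((fst q < fst v)%nat ->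
      INR (snd v) + s * (INR (fst q) - INR (fst v)) < INR (snd q))).
  { intros q Hq Hqv. destruct (Hm q Hq) as [K _]. pose proof (le_INR _ _ Hqv).
    split; [nra|]. intros Hq'. apply lt_INR in Hq'. nra. }
  split; [assumption|]. split.
  - split; [assumption|]. split; [assumption|]. split; [assumption|].
    unfold height; fold s; simpl. intros q Hq.
    destruct (le_lt_dec (fst q) (fst v)) as [Hc|Hc].
    + destruct (Hleft q Hq Hc) as [K1 K2]. split; [lra|]. intros E.
      split; [|lia]. apply Nat.nlt_ge. intros K. specialize (K2 K). lra.
    + destruct (Hright q Hq Hc) as [K1 K2]. split; [lra|]. intros E.
      split; [lia|]. apply Nat.nlt_ge. intros K. specialize (K2 K). lra.
  - split; [assumption|]. intros q Hq. rewrite Ev'.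
    replace (INR (snd v) + s * (INR (fst v') - INR (fst v)) + s * (INR (fst q) - INR (fst v')))
      with (INR (snd v) + s * (INR (fst q) - INR (fst v))) by ring.
    destruct (le_lt_dec (fst q) (fst v)) as [Hc|Hc].
    + split; [now apply Hleft|]. lia.
    + now apply Hright.
Qed.

Lemma below_segment_edge P e q : lower_edge P e -> P q ->
  (fst (fst e) <= fst q <= fst (snd e))%nat -> below_segment (fst e) (snd e) q.
Proof.
  destruct e as [v v']; simpl. intros [_ [_ [Hlt Hq]]] HS [H1 H2].
  simpl in Hlt.
  destruct (Hq q HS) as [K _]. unfold height, slope in K; simpl in K.
  apply le_INR in H1, H2. apply lt_INR in Hlt.
  set (d := INR (fst v') - INR (fst v)) in *.
  assert (Hd : 0 < d) by (unfold d; lra).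
  exists ((INR (fst q) - INR (fst v)) / d). split; [|split].
  - split.
    + apply Rmult_le_pos; [lra | left; now apply Rinv_0_lt_compat].
    + apply Rmult_le_reg_r with d; [assumption|]. unfold Rdiv.
      rewrite Rmult_assoc, Rinv_l; unfold d; lra.
  - replace (INR (fst v')) with (d + INR (fst v)) by (unfold d; ring).
    field. lra.
  - replace ((1 - (INR (fst q) - INR (fst v)) / d) * INR (snd v) +
       (INR (fst q) - INR (fst v)) / d * INR (snd v')) with
      (INR (snd v) + (INR (snd v') - INR (snd v)) / d * (INR (fst q) - INR (fst v)))
      by (field; lra).
    lra.
Qed.

(** Induction on a bound [k] for the horizontal distance still to cover. That all slopes exceed [m]
    is carried along because it separates the slope of a new first edge from those of the later
    edges. *)
Lemma lower_chain_from P D imax : box P D -> (forall q, P q -> (fst q <= imax)%nat) ->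
  (exists q, P q /\ fst q = imax) ->
  forall k v m, (imax - fst v <= k)%nat -> supports P v m ->
  exists es : list edge,
    Forall (lower_edge P) es /\ Forall (fun e => m < slope e) es /\
    NoDup (map slope es) /\ list_sum (map width es) = (imax - fst v)%nat /\
    ((fst v < imax)%nat -> (exists e, In e es /\ fst (fst e) = fst v) /\
                           (exists e, In e es /\ fst (snd e) = imax)) /\
    (forall q, P q -> (fst v <= fst q)%nat -> exists w w',
       In w (v :: map snd es) /\ In w' (v :: map snd es) /\ below_segment w w' q).
Proof.
  intros HS Himax [qmax [Hqmax Eqmax]].
  induction k as [|k IH]; intros v m Hk Hs;
    destruct (le_lt_dec imax (fst v)) as [Hi|Hi].
  1, 3: exists nil; split; [constructor|]; split; [constructor|]; split; [constructor|];
    split; [simpl; lia|]; split; [lia|];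
    intros q Hq Hvq; exists v, v; split; [now left|]; split; [now left|];
    exists 0; pose proof (Himax q Hq);
    assert (Eq : fst q = fst v) by lia;
    destruct Hs as [_ Hs]; destruct (Hs q Hq) as [K _];
    rewrite Eq in *; split; [lra|]; split; lra.
  - lia.
  - destruct (gift_wrap_step P D v m HS Hs) as [v' [Hm [He Hs']]].
    { exists qmax. split; [assumption|lia]. }
    pose proof He as [_ [Hv' [Hlt _]]]. simpl in Hlt, Hv'.
    pose proof (Himax _ Hv').
    destruct (IH v' (slope (v, v')) ltac:(lia) Hs') as [es [H1 [H2 [H3 [H4 [H6 H5]]]]]].
    exists ((v, v') :: es). split; [now constructor|]. split; [|split; [|split; [|split]]].
    + constructor; [assumption|]. revert H2. apply Forall_impl. intros e. lra.
    + simpl. constructor; [|assumption]. intros Hin. apply in_map_iff in Hin.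
      destruct Hin as [e [E Hin]]. rewrite Forall_forall in H2.
      specialize (H2 e Hin). lra.
    + simpl. rewrite H4. unfold width; simpl. lia.
    + intros _. split; [exists (v, v'); split; [now left | reflexivity]|].
      destruct (le_lt_dec imax (fst v')) as [Hc|Hc].
      * exists (v, v'). split; [now left|]. simpl. lia.
      * destruct (H6 Hc) as [_ [e [Hin E]]]. exists e. split; [now right | assumption].
    + intros q Hq Hvq. destruct (le_lt_dec (fst v') (fst q)) as [Hc|Hc].
      * destruct (H5 q Hq Hc) as [w [w' [K1 [K2 K3]]]].
        exists w, w'. split; [now right|]. split; [now right | assumption].
      * exists v, v'. split; [now left|]. split; [right; now left|].
        apply (below_segment_edge P (v, v')); simpl; auto; lia.
Qed.

Lemma lower_hull P D : box P D -> (exists q, P q) ->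
  exists imin imax (vs : list (nat * nat)) (es : list edge),
    (imin <= imax)%nat /\ length vs = (length es + 1)%nat /\ Forall P vs /\
    (forall q, P q -> (imin <= fst q <= imax)%nat) /\
    Forall (lower_edge P) es /\ NoDup (map slope es) /\
    list_sum (map width es) = (imax - imin)%nat /\
    ((imin < imax)%nat -> (exists e, In e es /\ fst (fst e) = imin) /\
                          (exists e, In e es /\ fst (snd e) = imax)) /\
    (forall q, P q -> exists w w', In w vs /\ In w' vs /\ below_segment w w' q).
Proof.
  intros HP Hex.
  destruct (finite_argmin P D (fun q => INR (fst q)) HP Hex) as [q1 [H1 Hmin1]].
  destruct (finite_argmin P D (fun q => - INR (fst q)) HP Hex) as [q2 [H2 Hmin2]].
  destruct (finite_argmin (fun q => P q /\ fst q = fst q1) D (fun q => INR (snd q)))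
    as [v [[Hv Ev] Hminv]].
  { intros q [Hq _]. now apply HP. }
  { now exists q1. }
  assert (Hlo : forall q, P q -> (fst q1 <= fst q)%nat) by (intros; now apply INR_le, Hmin1).
  assert (Hhi : forall q, P q -> (fst q <= fst q2)%nat).
  { intros q Hq. apply INR_le. specialize (Hmin2 q Hq). lra. }
  (* All ordinates lie in [0, D), so a line through the lowest point of the first column that falls
     by [D] per column passes strictly below everything to the right. *)
  assert (Hs : supports P v (- INR D)).
  { split; [assumption|]. intros q Hq. rewrite Ev.
    destruct (HP _ Hv) as [_ Hj]. apply lt_INR in Hj. pose proof (pos_INR (snd q)).
    destruct (Nat.eq_dec (fst q) (fst q1)) as [E|E].
    - rewrite E. specialize (Hminv q (conj Hq E)). split; [lra|lia].
    - pose proof (Hlo q Hq) as Hl. assert (Hl' : (fst q1 + 1 <= fst q)%nat) by lia.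
      apply le_INR in Hl'. rewrite plus_INR in Hl'. simpl in Hl'.
      pose proof (pos_INR D). pose proof (pos_INR (snd v)).
      assert (INR D * 1 <= INR D * (INR (fst q) - INR (fst q1)))
        by (apply Rmult_le_compat_l; lra).
      split; [|intros _]; lra. }
  destruct (lower_chain_from P D (fst q2) HP Hhi (ex_intro _ q2 (conj H2 eq_refl))
              (fst q2 - fst v) v (- INR D) (le_n _) Hs)
    as [es [K1 [_ [K3 [K4 [K5 K6]]]]]].
  rewrite Ev in *.
  exists (fst q1), (fst q2), (v :: map snd es), es.
  split; [now apply Hlo|]. split; [simpl; rewrite length_map; symmetry; apply Nat.add_1_r|].
  split.
  { constructor; [assumption|]. apply Forall_forall. intros w Hw.
    apply in_map_iff in Hw. destruct Hw as [e [<- He]].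
    rewrite Forall_forall in K1. now destruct (K1 e He) as [_ [? _]]. }
  split; [intros q Hq; split; auto|].
  repeat (split; [assumption|]).
  intros q Hq. apply K6; [assumption|]. now apply Hlo.
Qed.

(** On the vertical line through [q] the two segments have ordinates [l] and [h] with
    [l <= snd q <= h]. So [q] is a combination of one point on each segment, and the four ends
    receive product weights. *)
Lemma below_above_in_hull P q w w' u u' : P w -> P w' -> P u -> P u' ->
  below_segment w w' q ->
  (exists t, 0 <= t <= 1 /\
    INR (fst q) = (1 - t) * INR (fst u) + t * INR (fst u') /\
    INR (snd q) <= (1 - t) * INR (snd u) + t * INR (snd u')) ->
  in_conv_hull P (pt q).
Proof.
  intros Hw Hw' Hu Hu' [t [Ht [E1 L1]]] [r [Hr [E2 L2]]].
  set (l := (1 - t) * INR (snd w) + t * INR (snd w')) in *.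
  set (h := (1 - r) * INR (snd u) + r * INR (snd u')) in *.
  assert (Hs : exists s, 0 <= s <= 1 /\ INR (snd q) = (1 - s) * l + s * h).
  { destruct (Req_dec l h) as [E|E].
    - exists 0. split; lra.
    - exists ((INR (snd q) - l) / (h - l)). split; [split|].
      + apply Rmult_le_pos; [lra | left; apply Rinv_0_lt_compat; lra].
      + apply Rmult_le_reg_r with (h - l); [lra|]. unfold Rdiv.
        rewrite Rmult_assoc, Rinv_l; lra.
      + field. lra. }
  destruct Hs as [s [Hs E3]].
  exists ((w, (1 - s) * (1 - t)) :: (w', (1 - s) * t) :: (u, s * (1 - r)) :: (u', s * r) :: nil).
  split; [|split; [|split]]; simpl.
  - repeat (apply Forall_cons; [split; simpl; [assumption | apply Rmult_le_pos; lra]|]).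
    constructor.
  - ring.
  - transitivity ((1 - s) * INR (fst q) + s * INR (fst q)); [|ring].
    rewrite E1 at 1. rewrite E2. ring.
  - rewrite E3. unfold l, h. ring.
Qed.

Definition flip (D : nat) (p : nat * nat) : nat * nat := (fst p, (D - 1 - snd p)%nat).
(** The coefficients of [y^(D - 1) * f(x, 1 / y)]: reflecting the ordinates turns the upper hull
    into a lower hull. *)
Definition flip_coef (D : nat) (a : nat -> nat -> Cx) (i j : nat) : Cx :=
  if Nat.ltb j D then a i (D - 1 - j)%nat else C0.

Lemma finite_support_box a D : finite_support a D -> box (supp a) D.
Proof.
  intros H q Hq. split; apply Nat.nle_gt; intros K; apply Hq, H; [now left | now right].
Qed.

Lemma finite_support_flip a D : finite_support a D -> finite_support (flip_coef D a) D.
Proof.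
  intros H i j Hij. unfold flip_coef. destruct (Nat.ltb_spec j D); [|reflexivity].
  apply H. left. lia.
Qed.

Lemma supp_flip a D p : (snd p < D)%nat -> supp (flip_coef D a) p <-> supp a (flip D p).
Proof.
  intros H. unfold supp, flip_coef, flip; simpl.
  destruct (Nat.ltb_spec (snd p) D); [reflexivity|lia].
Qed.

Lemma flipK D p : (snd p < D)%nat -> flip D (flip D p) = p.
Proof. destruct p as [i j]; unfold flip; simpl; intros. f_equal. lia. Qed.

(** A support point on neither chain lies between a segment of the lower chain and a reflected
    segment of the other one. All four ends differ from it, so it is in the hull of the other
    support points and is not extreme. *)
Lemma newt_vertex_on_chains a D vs vs' p : finite_support a D ->
  Forall (supp a) vs -> Forall (supp (flip_coef D a)) vs' ->
  (forall q, supp a q -> exists w w', In w vs /\ In w' vs /\ below_segment w w' q) ->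
  (forall q, supp (flip_coef D a) q ->
     exists w w', In w vs' /\ In w' vs' /\ below_segment w w' q) ->
  newt_vertex a p -> In p (vs ++ map (flip D) vs').
Proof.
  intros HD Hvs Hvs' Hlow Hup [Hp Hext].
  destruct (excluded_middle_informative (In p (vs ++ map (flip D) vs'))) as [E|E]; [exact E|].
  exfalso. apply Hext.
  pose proof (finite_support_box a D HD) as HB.
  pose proof (finite_support_box _ D (finite_support_flip a D HD)) as HB'.
  destruct (HB p Hp) as [_ Hj].
  destruct (Hlow p Hp) as [w [w' [Hw [Hw' Hseg]]]].
  assert (Hfp : supp (flip_coef D a) (flip D p)).
  { apply supp_flip; [unfold flip; simpl; lia|]. now rewrite flipK. }
  destruct (Hup _ Hfp) as [u [u' [Hu [Hu' [t [Ht [E1 L1]]]]]]].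
  rewrite Forall_forall in Hvs, Hvs'.
  assert (Kl : forall x, In x vs -> supp a x /\ x <> p).
  { intros x Hx. split; [now apply Hvs|]. intros ->. apply E, in_or_app. now left. }
  assert (Ku : forall x, In x vs' -> (snd x < D)%nat /\ supp a (flip D x) /\ flip D x <> p).
  { intros x Hx. pose proof (Hvs' x Hx) as Sx. destruct (HB' x Sx) as [_ Hxj].
    split; [assumption|]. split; [now apply supp_flip|]. intros Ex.
    apply E, in_or_app. right. rewrite <- Ex. now apply in_map. }
  destruct (Ku u Hu) as [Bu [Su Nu]]. destruct (Ku u' Hu') as [Bu' [Su' Nu']].
  destruct (Kl w Hw) as [Sw Nw]. destruct (Kl w' Hw') as [Sw' Nw'].
  apply (below_above_in_hull _ p w w' (flip D u) (flip D u')); try (split; assumption);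
    [assumption|].
  assert (F : forall x, (snd x < D)%nat -> INR (snd (flip D x)) = INR D - 1 - INR (snd x)).
  { intros x Hx. unfold flip; simpl. rewrite !minus_INR by lia. reflexivity. }
  exists t. split; [assumption|]. split; [exact E1|].
  rewrite !F by assumption. rewrite F in L1 by assumption. lra.
Qed.

(** * Polar coordinates and sectors *)

Definition cis (t : R) : Cx := (cos t, sin t).
Definition rexp (t : R) : Cx := (exp t, 0).

Lemma cis_add s t : cis (s + t) = Cmul (cis s) (cis t).
Proof. unfold cis, Cmul; simpl. rewrite cos_plus, sin_plus. f_equal; ring. Qed.

Lemma cis_0 : cis 0 = C1.
Proof. unfold cis. now rewrite cos_0, sin_0. Qed.

Lemma cis_opp t : Cmul (cis t) (cis (- t)) = C1.
Proof. rewrite <- cis_add, Rplus_opp_r. apply cis_0. Qed.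

Lemma cis_pow t i : Cpow (cis t) i = cis (INR i * t).
Proof.
  induction i as [|i IH]; [simpl; rewrite Rmult_0_l; symmetry; apply cis_0|].
  rewrite S_INR. simpl Cpow. rewrite IH, <- cis_add. f_equal. ring.
Qed.

Lemma Cmod_cis t : Cmod (cis t) = 1.
Proof.
  unfold Cmod, cis; simpl. pose proof (sin2_cos2 t) as H. unfold Rsqr in H.
  rewrite Rplus_comm, H. apply sqrt_1.
Qed.

Lemma cis_neq0 t : cis t <> C0.
Proof. intros E. pose proof (Cmod_cis t) as H. rewrite E, Cmod_C0 in H. lra. Qed.

Lemma cis_period_nat t (n : nat) : cis (t + 2 * INR n * PI) = cis t.
Proof. unfold cis. now rewrite cos_period, sin_period. Qed.

Lemma cis_period t (l : Z) : cis (t - 2 * PI * IZR l) = cis t.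
Proof.
  destruct (Z_le_gt_dec 0 l) as [H|H].
  - rewrite <- (cis_period_nat (t - 2 * PI * IZR l) (Z.to_nat l)).
    f_equal. rewrite INR_IZR_INZ, Z2Nat.id by lia. ring.
  - rewrite <- (cis_period_nat t (Z.to_nat (- l))).
    f_equal. rewrite INR_IZR_INZ, Z2Nat.id, opp_IZR by lia. ring.
Qed.

Lemma rexp_add s t : rexp (s + t) = Cmul (rexp s) (rexp t).
Proof. unfold rexp, Cmul; simpl. rewrite exp_plus. f_equal; ring. Qed.

Lemma rexp_0 : rexp 0 = C1.
Proof. unfold rexp. now rewrite exp_0. Qed.

Lemma rexp_opp t : Cmul (rexp t) (rexp (- t)) = C1.
Proof. rewrite <- rexp_add, Rplus_opp_r. apply rexp_0. Qed.

Lemma rexp_pow t i : Cpow (rexp t) i = rexp (INR i * t).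
Proof.
  induction i as [|i IH]; [simpl; rewrite Rmult_0_l; symmetry; apply rexp_0|].
  rewrite S_INR. simpl Cpow. rewrite IH, <- rexp_add. f_equal. ring.
Qed.

Lemma Cmod_rexp t : Cmod (rexp t) = exp t.
Proof.
  unfold Cmod, rexp; simpl. rewrite Rmult_0_l, Rplus_0_r.
  apply sqrt_square. left. apply exp_pos.
Qed.

Lemma rexp_neq0 t : rexp t <> C0.
Proof.
  intros E. pose proof (Cmod_rexp t) as H. rewrite E, Cmod_C0 in H.
  pose proof (exp_pos t). lra.
Qed.

Lemma Cpow_mul z w i : Cpow (Cmul z w) i = Cmul (Cpow z i) (Cpow w i).
Proof. induction i as [|i IH]; simpl; [ring|]. rewrite IH. ring. Qed.

Lemma Cpow_neq0 z i : z <> C0 -> Cpow z i <> C0.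
Proof. intros H. induction i; simpl; [apply C1_neq0 | now apply Cmul_neq0]. Qed.

Lemma eventually_lt_INR_mul d B : 0 < d -> eventually (fun n => B < INR n * d).
Proof.
  intros Hd. destruct (INR_archimed d B Hd) as [N HN].
  exists N. intros n Hn. apply le_INR in Hn. nra.
Qed.

Lemma Clim_rexp_neg d : d < 0 -> Clim (fun n => rexp (INR n * d)) C0.
Proof.
  intros Hd. apply Clim_dist. intros eps He.
  destruct (eventually_lt_INR_mul (- d) (- ln eps) ltac:(lra)) as [N HN].
  exists N. intros n Hn. specialize (HN n Hn).
  replace (Csub (rexp (INR n * d)) C0) with (rexp (INR n * d)) by ring.
  rewrite Cmod_rexp. rewrite <- (exp_ln eps He). apply exp_increasing. lra.
Qed.

Lemma Clim_rexp_0 d : d = 0 -> Clim (fun n => rexp (INR n * d)) C1.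
Proof.
  intros ->. eapply Clim_ext_loc; [|apply Clim_const].
  exists O. intros n _. now rewrite Rmult_0_r, rexp_0.
Qed.

(** The angle is not reduced modulo [2 * PI]; thus [sector beta (alpha + 2 * PI)] can describe the
    open sector complementary to the one from [alpha] to [beta], although it crosses the positive
    real axis. *)
Definition sector (alpha beta : R) (z : Cx) : Prop :=
  exists rho phi, 0 < rho /\ alpha < phi < beta /\ z = (rho * cos phi, rho * sin phi).

Lemma polar z : z <> C0 -> exists phi, exists rho, 0 < rho /\ z = (rho * cos phi, rho * sin phi).
Proof.
  intros Hz. pose proof (Cmod_pos z Hz) as Hp. destruct z as [x y].
  set (r := Cmod (x, y)) in *.
  assert (Hr : r * r = x * x + y * y).
  { unfold r, Cmod; simpl. apply sqrt_sqrt. nra. }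
  assert (Hx : -1 <= x / r <= 1).
  { split; apply Rmult_le_reg_r with r; try assumption;
      unfold Rdiv; rewrite Rmult_assoc, Rinv_l; nra. }
  assert (Hs : sqrt (1 - (x / r)²) = Rabs y / r).
  { apply sqrt_lem_1.
    - unfold Rsqr. nra.
    - apply Rmult_le_pos; [apply Rabs_pos | left; now apply Rinv_0_lt_compat].
    - pose proof (Rsqr_abs y) as Ha. unfold Rsqr in *.
      replace (Rabs y / r * (Rabs y / r)) with (Rabs y * Rabs y / (r * r)) by (field; lra).
      rewrite <- Ha.
      replace (y * y) with (r * r - x * x) by lra. field. lra. }
  destruct (Rle_lt_dec 0 y) as [Hy|Hy].
  - exists (acos (x / r)), r. split; [assumption|].
    rewrite cos_acos, sin_acos, Hs, Rabs_right by lra. f_equal; field; lra.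
  - exists (- acos (x / r)), r. split; [assumption|].
    rewrite cos_neg, sin_neg, cos_acos, sin_acos, Hs, Rabs_left by lra. f_equal; field; lra.
Qed.

Lemma sector_scale alpha beta t z : sector alpha beta z -> sector alpha beta (Cmul (rexp t) z).
Proof.
  intros [rho [phi [Hr [Hphi ->]]]]. exists (exp t * rho), phi.
  split; [apply Rmult_lt_0_compat; [apply exp_pos | assumption]|].
  split; [assumption|]. unfold Cmul, rexp; simpl. f_equal; ring.
Qed.

(** In coordinates turned by [phi] and scaled by [rho], a point [w] near [z] becomes [(A, B)] with
    [A] near 1 and [B] near 0. Then [phi + atan (B / A)] is an argument of [w], and it is close to
    [phi] by continuity of [atan] at 0. *)
Lemma sector_open alpha beta z : sector alpha beta z ->
  exists eps, 0 < eps /\ forall w, Cmod (Csub w z) < eps -> sector alpha beta w.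
Proof.
  intros [rho [phi [Hr [Hphi ->]]]].
  set (eta := Rmin (phi - alpha) (beta - phi)).
  assert (Heta : 0 < eta) by (apply Rmin_glb_lt; lra).
  assert (Hc : continuity_pt atan 0)
    by (apply derivable_continuous_pt; apply derivable_pt_atan).
  destruct (Hc eta Heta) as [del [Hdel Hat]].
  (* Both [A - 1] and [B] will be at most [d / 2] in absolute value. The bound 1/2 keeps [A] above
     1/2, so [B / A] stays within [d], which is less than [del]. *)
  set (d := Rmin (1 / 2) (del / 2)).
  assert (Hd : 0 < d) by (apply Rmin_glb_lt; lra).
  exists (rho * d / 4). split; [nra|]. intros [w1 w2] Hw.
  rewrite Cmod_Coquelicot in Hw.
  pose proof (Rmax_Cmod (Csub (w1, w2) (rho * cos phi, rho * sin phi))) as HM.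
  simpl in HM.
  pose proof (Rmax_l (Rabs (w1 - rho * cos phi)) (Rabs (w2 - rho * sin phi))) as M1.
  pose proof (Rmax_r (Rabs (w1 - rho * cos phi)) (Rabs (w2 - rho * sin phi))) as M2.
  assert (B1 : Rabs (w1 - rho * cos phi) < rho * d / 4) by lra.
  assert (B2 : Rabs (w2 - rho * sin phi) < rho * d / 4) by lra.
  apply Rabs_def2 in B1, B2.
  pose proof (COS_bound phi) as C. pose proof (SIN_bound phi) as S.
  pose proof (sin2_cos2 phi) as SC. unfold Rsqr in SC.
  set (A := (w1 * cos phi + w2 * sin phi) / rho).
  set (B := (w2 * cos phi - w1 * sin phi) / rho).
  assert (EA : w1 = rho * (A * cos phi - B * sin phi)).
  { unfold A, B. transitivity (w1 * (sin phi * sin phi + cos phi * cos phi)); [rewrite SC; ring|].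
    field. lra. }
  assert (EB : w2 = rho * (A * sin phi + B * cos phi)).
  { unfold A, B. transitivity (w2 * (sin phi * sin phi + cos phi * cos phi)); [rewrite SC; ring|].
    field. lra. }
  assert (HA : Rabs (rho * (A - 1)) <= rho * d / 2).
  { replace (rho * (A - 1)) with
      ((w1 - rho * cos phi) * cos phi + (w2 - rho * sin phi) * sin phi).
    - apply Rabs_le. split; nra.
    - unfold A. transitivity (w1 * cos phi + w2 * sin phi
        - rho * (sin phi * sin phi + cos phi * cos phi)); [ring|]. rewrite SC. field. lra. }
  assert (HB : Rabs (rho * B) <= rho * d / 2).
  { replace (rho * B) with
      ((w2 - rho * sin phi) * cos phi - (w1 - rho * cos phi) * sin phi).
    - apply Rabs_le. split; nra.
    - unfold B. field. lra. }
  rewrite Rabs_mult, (Rabs_right rho) in HA, HB by lra.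
  assert (HA' : Rabs (A - 1) <= d / 2) by nra.
  assert (HB' : Rabs B <= d / 2) by nra.
  assert (Hd1 : d <= 1 / 2) by apply Rmin_l.
  assert (Hd2 : d <= del / 2) by apply Rmin_r.
  assert (HA2 : 1 / 2 < A).
  { pose proof (Rle_abs (- (A - 1))) as K. rewrite Rabs_Ropp in K. lra. }
  set (t := B / A).
  assert (Ht : Rabs t < del).
  { unfold t, Rdiv. rewrite Rabs_mult, Rabs_inv, (Rabs_right A) by lra.
    apply Rmult_lt_reg_r with A; [lra|]. rewrite Rmult_assoc, Rinv_l by lra. nra. }
  assert (Hpsi : Rabs (atan t) < eta).
  { destruct (Req_dec t 0) as [E|E].
    - rewrite E, atan_0, Rabs_R0. assumption.
    - specialize (Hat t). simpl in Hat. unfold R_dist in Hat.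
      rewrite atan_0, !Rminus_0_r in Hat. apply Hat. split; [|assumption].
      split; [exact I | now apply not_eq_sym]. }
  apply Rabs_def2 in Hpsi.
  assert (He1 : eta <= phi - alpha) by apply Rmin_l.
  assert (He2 : eta <= beta - phi) by apply Rmin_r.
  assert (Hsq : 0 < sqrt (1 + t²)) by (apply sqrt_lt_R0; unfold Rsqr; nra).
  exists (rho * (A * sqrt (1 + t²))), (phi + atan t).
  split; [apply Rmult_lt_0_compat; [assumption|]; apply Rmult_lt_0_compat; lra|].
  split; [lra|].
  rewrite cos_plus, sin_plus, cos_atan, sin_atan.
  rewrite EA at 1. rewrite EB at 1.
  assert (EBt : B = A * t) by (unfold t; field; lra).
  rewrite EBt. f_equal; field; lra.
Qed.

Lemma cos_lt_1 x : 0 < x < 2 * PI -> cos x < 1.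
Proof.
  intros H. replace x with (2 * (x / 2)) by field. rewrite cos_2a_sin.
  assert (0 < sin (x / 2)) by (apply sin_gt_0; lra). nra.
Qed.

Lemma sector_has_arg alpha beta z : 0 <= alpha -> beta <= 2 * PI -> sector alpha beta z ->
  exists phi, has_arg z phi /\ alpha <= phi <= beta.
Proof.
  intros Ha Hb [rho [phi [Hr [Hphi ->]]]]. exists phi.
  assert (E : Cmod (rho * cos phi, rho * sin phi) = rho).
  { unfold Cmod; simpl. replace (_ + _) with (rho * rho).
    - apply sqrt_square. lra.
    - pose proof (sin2_cos2 phi) as SC. unfold Rsqr in SC.
      transitivity (rho * rho * (sin phi * sin phi + cos phi * cos phi)); [rewrite SC; ring|ring]. }
  split; [|lra]. split; [lra|]. rewrite E. simpl. tauto.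
Qed.

(** Otherwise [z] would have two arguments differing by an amount strictly between 0 and [2 * PI].
    The cosine of the difference would be below 1, while two arguments of the same nonzero number
    force it to be 1. *)
Lemma sector_complement_has_arg alpha beta z : sector beta (alpha + 2 * PI) z ->
  ~ exists phi, has_arg z phi /\ alpha <= phi <= beta.
Proof.
  intros [rho [phi [Hr [Hphi ->]]]] [psi [[Hpsi [E1 E2]] Hab]].
  simpl in E1, E2. set (m := Cmod _) in *.
  assert (K : cos (phi - psi) < 1) by (apply cos_lt_1; lra).
  assert (Hm : 0 <= m) by apply Cmod_nonneg.
  pose proof (sin2_cos2 phi) as S1. pose proof (sin2_cos2 psi) as S2. unfold Rsqr in S1, S2.
  assert (Em : m * m = rho * rho).
  { transitivity ((m * cos psi) * (m * cos psi) + (m * sin psi) * (m * sin psi)).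
    - transitivity (m * m * (sin psi * sin psi + cos psi * cos psi)); [rewrite S2; ring|ring].
    - rewrite <- E1, <- E2.
      transitivity (rho * rho * (sin phi * sin phi + cos phi * cos phi)); [ring|rewrite S1; ring]. }
  assert (m = rho) by nra. subst m. rewrite H in *.
  assert (cos phi = cos psi) by nra. assert (sin phi = sin psi) by nra.
  rewrite cos_minus, H0, H1 in K. nra.
Qed.

(** * Edge polynomials *)

Lemma Csum_ext n F G : (forall i, (i < n)%nat -> F i = G i) -> Csum n F = Csum n G.
Proof.
  induction n as [|n IH]; simpl; intros H; [reflexivity|].
  rewrite IH by (intros; apply H; lia). now rewrite H by lia.
Qed.

Lemma Csum_mul_l n F k : Cmul k (Csum n F) = Csum n (fun i => Cmul k (F i)).
Proof. induction n as [|n IH]; simpl; [ring|]. rewrite <- IH. ring. Qed.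

Lemma Csum_0 n F : (forall i, (i < n)%nat -> F i = C0) -> Csum n F = C0.
Proof.
  induction n as [|n IH]; simpl; intros H; [reflexivity|].
  rewrite IH by (intros; apply H; lia). rewrite H by lia. ring.
Qed.

Lemma Csum_single n F i0 : (i0 < n)%nat ->
  (forall i, i <> i0 -> F i = C0) -> Csum n F = F i0.
Proof.
  induction n as [|n IH]; simpl; intros Hi H; [lia|].
  destruct (Nat.eq_dec i0 n) as [->|E].
  - rewrite Csum_0 by (intros; apply H; lia). ring.
  - rewrite IH by (assumption || lia). rewrite (H n) by lia. ring.
Qed.

Lemma decP_true P : decP P = true <-> P.
Proof. unfold decP. destruct (excluded_middle_informative P); split; auto; discriminate. Qed.

Lemma decP_elim P : decP P = true -> P.
Proof. apply decP_true. Qed.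

Definition ycoef (a : nat -> nat -> Cx) (D : nat) (y : Cx) (i : nat) : Cx :=
  Csum D (fun j => Cmul (a i j) (Cpow y j)).

Lemma eval2_ycoef a D x y : eval2 a D x y = Csum D (fun i => Cmul (ycoef a D y i) (Cpow x i)).
Proof.
  unfold eval2, ycoef. apply Csum_ext. intros i _.
  transitivity (Cmul (Cpow x i) (Csum D (fun j => Cmul (a i j) (Cpow y j)))); [|ring].
  rewrite Csum_mul_l. apply Csum_ext. intros. ring.
Qed.

Definition on_edge (e : edge) (i j : nat) : Prop := INR j - slope e * INR i = height e.

(** At most one [j] contributes. Summing over all of them avoids asking whether
    [height e + slope e * i] is a natural number. *)
Definition edge_coef (a : nat -> nat -> Cx) (D : nat) (e : edge) (i : nat) : Cx :=
  Csum D (fun j => if decP (on_edge e i j) then a i j else C0).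

Lemma on_edge_fst e : on_edge e (fst (fst e)) (snd (fst e)).
Proof. reflexivity. Qed.

Lemma on_edge_snd e : (fst (fst e) < fst (snd e))%nat -> on_edge e (fst (snd e)) (snd (snd e)).
Proof.
  intros H. apply lt_INR in H. unfold on_edge, height, slope. field. lra.
Qed.

Lemma edge_coef_at a D e i j : finite_support a D -> supp a (i, j) -> on_edge e i j ->
  edge_coef a D e i = a i j.
Proof.
  intros HD Hs He. destruct (finite_support_box a D HD _ Hs) as [_ Hj]. simpl in Hj.
  unfold edge_coef. rewrite (Csum_single D _ j Hj).
  - now rewrite (proj2 (decP_true _) He).
  - intros j' Hne. destruct (decP (on_edge e i j')) eqn:E; [|reflexivity].
    apply decP_elim in E. exfalso. apply Hne, INR_eq. unfold on_edge in *. lra.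
Qed.

Lemma edge_coef_out a D e i : lower_edge (supp a) e ->
  (i < fst (fst e))%nat \/ (fst (snd e) < i)%nat -> edge_coef a D e i = C0.
Proof.
  intros [_ [_ [_ He]]] Hi. apply Csum_0. intros j _.
  destruct (decP (on_edge e i j)) eqn:E; [|reflexivity].
  apply decP_elim in E. destruct (excluded_middle_informative (a i j = C0)) as [Z|Z]; [exact Z|].
  destruct (He (i, j) Z) as [_ K]. specialize (K E). simpl in K. lia.
Qed.

(** After scaling, the term of exponent [j] has size proportional to [exp (n * d)] with
    [d = height e + slope e * i - j]. This [d] is zero on the line of the edge and negative at every
    other support point, so only the edge survives; there [j] equals [height e + slope e * i], which
    gives the phase. *)
Lemma ycoef_limit a D e i theta : lower_edge (supp a) e ->
  Clim (fun n => Cmul (rexp (INR n * (height e + slope e * INR i)))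
                      (ycoef a D (Cmul (rexp (- INR n)) (cis theta)) i))
       (Cmul (cis ((height e + slope e * INR i) * theta)) (edge_coef a D e i)).
Proof.
  intros [_ [_ [_ He]]]. unfold ycoef, edge_coef.
  rewrite Csum_mul_l.
  eapply Clim_ext_loc; [exists O; intros n _; symmetry; apply Csum_mul_l|].
  apply Clim_sum. intros j _.
  set (d := height e + slope e * INR i - INR j).
  assert (E : forall n, Cmul (rexp (INR n * (height e + slope e * INR i)))
      (Cmul (a i j) (Cpow (Cmul (rexp (- INR n)) (cis theta)) j)) =
      Cmul (rexp (INR n * d)) (Cmul (a i j) (cis (INR j * theta)))).
  { intros n. rewrite Cpow_mul, rexp_pow, cis_pow. unfold d.
    replace (INR n * (height e + slope e * INR i - INR j)) with
      (INR n * (height e + slope e * INR i) + INR j * - INR n) by ring.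
    rewrite rexp_add. ring. }
  eapply Clim_ext_loc; [exists O; intros n _; symmetry; apply E|].
  destruct (decP (on_edge e i j)) eqn:Ed.
  - apply decP_elim in Ed. unfold on_edge in Ed.
    replace ((height e + slope e * INR i) * theta) with (INR j * theta) by (f_equal; lra).
    replace (Cmul (cis (INR j * theta)) (a i j)) with
      (Cmul C1 (Cmul (a i j) (cis (INR j * theta)))) by ring.
    apply Clim_mul; [|apply Clim_const]. apply Clim_rexp_0. unfold d. lra.
  - replace (Cmul (cis ((height e + slope e * INR i) * theta)) C0) with
      (Cmul C0 (Cmul (a i j) (cis (INR j * theta)))) by ring.
    destruct (excluded_middle_informative (a i j = C0)) as [Z|Z].
    + rewrite Z. eapply Clim_ext_loc; [|].
      2: { replace (Cmul C0 (Cmul C0 (cis (INR j * theta)))) with C0 by ring. apply Clim_const. }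
      exists O. intros n _. simpl. ring.
    + apply Clim_mul; [|apply Clim_const]. apply Clim_rexp_neg.
      destruct (He (i, j) Z) as [K _]. simpl in K.
      assert (INR j - slope e * INR i <> height e).
      { intros K'. assert (decP (on_edge e i j) = true) by now apply decP_true. congruence. }
      unfold d. lra.
Qed.

(** The substitution [x = exp (n * slope e) * z] brings the roots belonging to [e] to bounded size.
    The phases combine into powers of [cis (slope e * theta)], so the nonzero roots of the limit are
    those of the edge polynomial turned by [- slope e * theta]. *)
Lemma eval2_limit a D e theta z : lower_edge (supp a) e ->
  Clim (fun n => Cmul (rexp (INR n * height e))
          (eval2 a D (Cmul (rexp (INR n * slope e)) z) (Cmul (rexp (- INR n)) (cis theta))))
       (Cmul (cis (height e * theta))
          (Csum D (fun i => Cmul (edge_coef a D e i) (Cpow (Cmul (cis (slope e * theta)) z) i)))).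
Proof.
  intros He. rewrite Csum_mul_l.
  apply Clim_ext_loc with (b := fun n => Csum D (fun i => Cmul (rexp (INR n * height e))
    (Cmul (ycoef a D (Cmul (rexp (- INR n)) (cis theta)) i)
          (Cpow (Cmul (rexp (INR n * slope e)) z) i)))).
  { exists O. intros n _. now rewrite eval2_ycoef, Csum_mul_l. }
  apply Clim_sum. intros i _.
  replace (Cmul (cis (height e * theta))
     (Cmul (edge_coef a D e i) (Cpow (Cmul (cis (slope e * theta)) z) i))) with
    (Cmul (Cmul (cis ((height e + slope e * INR i) * theta)) (edge_coef a D e i)) (Cpow z i)).
  2: { rewrite Cpow_mul, cis_pow.
       replace ((height e + slope e * INR i) * theta) with
         (height e * theta + INR i * (slope e * theta)) by ring.
       rewrite cis_add. ring. }
  eapply Clim_ext_loc.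
  2: { apply Clim_mul; [apply (ycoef_limit a D e i theta He) | apply Clim_const]. }
  exists O. intros n _. rewrite Cpow_mul, rexp_pow.
  replace (INR n * (height e + slope e * INR i)) with
    (INR n * height e + INR i * (INR n * slope e)) by ring.
  rewrite rexp_add. ring.
Qed.

(** The annulus excludes the root 0 and, once the scaling is undone, makes the regions of edges with
    different slopes disjoint for large [n]. *)
Definition root_region (rad alpha beta : R) (z : Cx) : bool :=
  decP (sector alpha beta z /\ / rad < Cmod z < rad).

Lemma root_region_open rad alpha beta z : root_region rad alpha beta z = true ->
  exists eps, 0 < eps /\
    forall w, Cmod (Csub w z) < eps -> root_region rad alpha beta w = true.
Proof.
  intros H. apply decP_elim in H. destruct H as [Hs Hm].
  destruct (sector_open _ _ _ Hs) as [e1 [He1 H1]].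
  exists (Rmin e1 (Rmin (Cmod z - / rad) (rad - Cmod z))). split.
  - repeat apply Rmin_glb_lt; lra.
  - intros w Hw.
    pose proof (Rmin_l e1 (Rmin (Cmod z - / rad) (rad - Cmod z))) as A1.
    pose proof (Rmin_r e1 (Rmin (Cmod z - / rad) (rad - Cmod z))) as A2.
    pose proof (Rmin_l (Cmod z - / rad) (rad - Cmod z)) as A3.
    pose proof (Rmin_r (Cmod z - / rad) (rad - Cmod z)) as A4.
    assert (Z0 : forall x, Cmod (Csub x C0) = Cmod x) by (intros; f_equal; ring).
    pose proof (Cmod_triangle_sub w z C0) as T1. pose proof (Cmod_triangle_sub z w C0) as T2.
    rewrite !Z0 in T1, T2. rewrite (Cmod_sub_sym z w) in T2.
    apply decP_true. split; [apply H1; lra | lra].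
Qed.

Lemma filter_map_length {A B} (f : B -> bool) (g : A -> B) l :
  length (filter f (map g l)) = length (filter (fun x => f (g x)) l).
Proof. induction l as [|x l IH]; simpl; [reflexivity|]. destruct (f (g x)); simpl; auto. Qed.

Lemma filter_length_mono {A} (f g : A -> bool) l :
  (forall x, In x l -> f x = true -> g x = true) ->
  (length (filter f l) <= length (filter g l))%nat.
Proof.
  induction l as [|x l IH]; simpl; intros H; [lia|].
  assert (K := IH (fun y Hy => H y (or_intror Hy))).
  destruct (f x) eqn:E.
  - rewrite (H x (or_introl eq_refl) E). simpl. lia.
  - destruct (g x); simpl; lia.
Qed.

(** Semicontinuity applied to the rescaled roots. The powers of [z] on both sides are written as
    lists of zeros, which the annulus discards afterwards, and all scale factors are absorbed into
    [c] and [kap]. *)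
Lemma edge_root_count a D e theta Z imin imax rad alpha beta (rs : nat -> list Cx) :
  lower_edge (supp a) e -> edge_coef a D e (fst (snd e)) <> C0 ->
  (forall z, Csum D (fun i => Cmul (edge_coef a D e i) (Cpow z i)) =
     Cmul (edge_coef a D e (fst (snd e))) (Cmul (Cpow z (fst (fst e))) (Cprod_lin z Z))) ->
  0 < rad ->
  (forall n, (length (rs n) <= imax - imin)%nat) ->
  eventually (fun n => forall z,
     eval2 a D z (Cmul (rexp (- INR n)) (cis theta)) =
     Cmul (ycoef a D (Cmul (rexp (- INR n)) (cis theta)) imax)
          (Cmul (Cpow z imin) (Cprod_lin z (rs n)))) ->
  eventually (fun n =>
    (length (filter (root_region rad alpha beta) (map (Cmul (cis (- (slope e * theta)))) Z)) <=
     length (filter (fun r => root_region rad alpha beta (Cmul (rexp (- (INR n * slope e))) r))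
                    (rs n)))%nat).
Proof.
  intros He Hhi HZ Hrad Hlen Hrs.
  assert (Hnz : forall l, filter (root_region rad alpha beta) (repeat C0 l) = nil).
  { intros l. induction l as [|l IH]; [reflexivity|]. simpl.
    destruct (root_region rad alpha beta C0) eqn:E; [|exact IH].
    apply decP_elim in E. rewrite Cmod_C0 in E. destruct E as [_ [E _]].
    pose proof (Rinv_0_lt_compat _ Hrad). lra. }
  set (lo := fst (fst e)) in *. set (hi := fst (snd e)) in *.
  set (w := cis (slope e * theta)).
  set (L := fun n => repeat C0 imin ++ map (Cmul (rexp (- (INR n * slope e)))) (rs n)).
  set (c := fun n => Cmul (rexp (INR n * height e))
     (Cmul (ycoef a D (Cmul (rexp (- INR n)) (cis theta)) imax)
        (Cmul (Cpow (rexp (INR n * slope e)) imin)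
              (Cpow (rexp (INR n * slope e)) (length (rs n)))))).
  set (kap := Cmul (cis (height e * theta)) (Cmul (edge_coef a D e hi)
     (Cmul (Cpow w lo) (Cpow w (length Z))))).
  assert (K : eventually (fun n =>
     (length (filter (root_region rad alpha beta)
        (repeat C0 lo ++ map (Cmul (cis (- (slope e * theta)))) Z)) <=
      length (filter (root_region rad alpha beta) (L n)))%nat)).
  { apply (root_count_semicontinuous _ _ kap c L (imin + (imax - imin))).
    - apply root_region_open.
    - unfold kap. repeat apply Cmul_neq0; try apply Cpow_neq0; try apply cis_neq0. exact Hhi.
    - intros n. unfold L. rewrite length_app, repeat_length, length_map.
      specialize (Hlen n). lia.
    - intros z. pose proof (eval2_limit a D e theta z He) as Lim.
      rewrite HZ in Lim. fold w in Lim.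
      replace (Cmul kap _) with (Cmul (cis (height e * theta))
         (Cmul (edge_coef a D e hi) (Cmul (Cpow (Cmul w z) lo) (Cprod_lin (Cmul w z) Z)))).
      2: { rewrite (Cprod_lin_scale w (cis (- (slope e * theta)))) by apply cis_opp.
           rewrite Cpow_mul, Cprod_lin_app, <- Cpow_prod_lin. unfold kap. ring. }
      eapply Clim_ext_loc; [|exact Lim].
      revert Hrs. apply filter_imp. intros n Hn. rewrite Hn.
      rewrite (Cprod_lin_scale (rexp (INR n * slope e)) (rexp (- (INR n * slope e)))) by apply rexp_opp.
      unfold c, L. rewrite Cpow_mul, Cprod_lin_app, <- Cpow_prod_lin. ring. }
  revert K. apply filter_imp. intros n. unfold L.
  rewrite !filter_app, !Hnz. simpl. now rewrite (filter_map_length _ (Cmul (rexp _))).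
Qed.

Lemma list_sum_map_mono {A} (f g : A -> nat) l :
  (forall x, In x l -> (f x <= g x)%nat) -> (list_sum (map f l) <= list_sum (map g l))%nat.
Proof.
  induction l as [|x l IH]; simpl; intros H; [lia|].
  pose proof (H x (or_introl eq_refl)). specialize (IH (fun y Hy => H y (or_intror Hy))). lia.
Qed.

Lemma disjoint_filters_count {A B} (es : list A) (f : A -> B -> bool) (g : B -> bool) l :
  NoDup es ->
  (forall e e' x, In e es -> In e' es -> In x l -> f e x = true -> f e' x = true -> e = e') ->
  (forall e x, In e es -> In x l -> f e x = true -> g x = true) ->
  (list_sum (map (fun e => length (filter (f e) l)) es) <= length (filter g l))%nat.
Proof.
  intros Hnd. revert g. induction Hnd as [|e es Hni Hnd IH]; intros g Hdis Hg; simpl; [lia|].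
  specialize (IH (fun x => andb (g x) (negb (f e x)))).
  assert (K : (length (filter (f e) l) + length (filter (fun x => g x && negb (f e x))%bool l) <=
               length (filter g l))%nat).
  { clear IH Hdis. induction l as [|x l IHl]; simpl; [lia|].
    assert (K := IHl (fun e' y H1 H2 => Hg e' y H1 (or_intror H2))).
    destruct (f e x) eqn:E.
    - rewrite (Hg e x (or_introl eq_refl) (or_introl eq_refl) E). simpl. lia.
    - destruct (g x); simpl; lia. }
  assert (K' : (list_sum (map (fun e0 => length (filter (f e0) l)) es) <=
                length (filter (fun x => g x && negb (f e x))%bool l))%nat).
  { apply IH.
    - intros e1 e2 x H1 H2. apply Hdis; now right.
    - intros e' x He' Hx E. rewrite (Hg e' x (or_intror He') Hx E). simpl.
      destruct (f e x) eqn:E'; [|reflexivity]. exfalso. apply Hni.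
      replace e with e'; [assumption|].
      apply (Hdis e' e x); auto; [now right | now left]. }
  lia.
Qed.

Lemma eventually_forall_list {A} (l : list A) (P : A -> nat -> Prop) :
  (forall x, In x l -> eventually (P x)) -> eventually (fun n => forall x, In x l -> P x n).
Proof.
  induction l as [|x l IH]; intros H.
  - exists O. intros n _ y [].
  - generalize (filter_and _ _ (H x (or_introl eq_refl)) (IH (fun y Hy => H y (or_intror Hy)))).
    apply filter_imp. intros n [H1 H2] y [<-|Hy]; auto.
Qed.

(** If the modulus of [r] is within a factor [rad] of the scales of two edges with different slopes,
    then [exp (n * delta) < rad * rad], where [delta > 0] is the difference of the slopes. This
    fails for large [n]. *)
Lemma scales_separate rad (es : list edge) : 0 < rad -> NoDup (map slope es) ->
  eventually (fun n => forall e, In e es -> forall e', In e' es -> forall r,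
    / rad < Cmod (Cmul (rexp (- (INR n * slope e))) r) < rad ->
    / rad < Cmod (Cmul (rexp (- (INR n * slope e'))) r) < rad -> e = e').
Proof.
  intros Hrad Hnd.
  assert (Hinj : forall e e', In e es -> In e' es -> slope e = slope e' -> e = e').
  { intros e e' He He' E. clear Hrad. induction es as [|x l IH]; [destruct He|].
    simpl in Hnd. inversion Hnd as [|? ? Hni Hnd']; subst.
    destruct He as [->|He], He' as [->|He']; auto.
    - exfalso. apply Hni. rewrite E. now apply in_map.
    - exfalso. apply Hni. rewrite <- E. now apply in_map. }
  assert (Hlt : forall e e', In e es -> In e' es -> slope e < slope e' ->
    eventually (fun n => forall r,
    / rad < Cmod (Cmul (rexp (- (INR n * slope e))) r) < rad ->
    / rad < Cmod (Cmul (rexp (- (INR n * slope e'))) r) < rad -> False)).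
  { intros e e' He He' Hs.
    generalize (eventually_lt_INR_mul (slope e' - slope e) (ln (rad * rad)) ltac:(lra)).
    apply filter_imp. intros n Hn r [_ H1] [H2 _].
    rewrite Cmod_mul, Cmod_rexp in H1, H2.
    assert (Hrr : 0 < rad * rad) by nra.
    apply exp_increasing in Hn. rewrite exp_ln in Hn by assumption.
    replace (- (INR n * slope e)) with
      (INR n * (slope e' - slope e) + - (INR n * slope e')) in H1 by ring.
    rewrite exp_plus in H1. pose proof (Rinv_0_lt_compat _ Hrad) as Hi.
    set (q := exp (- (INR n * slope e')) * Cmod r) in *.
    assert (H3 : exp (INR n * (slope e' - slope e)) * q < rad) by (unfold q; lra).
    assert (rad * rad * / rad < rad); [|rewrite Rmult_assoc, Rinv_r in H; lra].
    apply Rle_lt_trans with (exp (INR n * (slope e' - slope e)) * q); [|assumption].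
    apply Rmult_le_compat; lra. }
  apply eventually_forall_list. intros e He. apply eventually_forall_list. intros e' He'.
  destruct (Rtotal_order (slope e) (slope e')) as [H|[H|H]].
  - generalize (Hlt e e' He He' H). apply filter_imp. intros n Hn r H1 H2.
    destruct (Hn r H1 H2).
  - exists O. intros n _ r _ _. now apply Hinj.
  - generalize (Hlt e' e He' He H). apply filter_imp. intros n Hn r H1 H2.
    destruct (Hn r H2 H1).
Qed.

Lemma edge_coef_endpoints a D e : finite_support a D -> lower_edge (supp a) e ->
  edge_coef a D e (fst (fst e)) <> C0 /\ edge_coef a D e (fst (snd e)) <> C0.
Proof.
  destruct e as [[i j] [i' j']]. intros HD He. pose proof He as [H1 [H2 [Hlt _]]]. simpl in *.
  rewrite (edge_coef_at a D _ i j HD H1 (on_edge_fst ((i, j), (i', j')))).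
  rewrite (edge_coef_at a D _ i' j' HD H2 (on_edge_snd ((i, j), (i', j')) Hlt)).
  split; assumption.
Qed.

Lemma edge_roots a D e : finite_support a D -> lower_edge (supp a) e ->
  exists Z, length Z = width e /\ Forall (fun r => r <> C0) Z /\
    forall z, Csum D (fun i => Cmul (edge_coef a D e i) (Cpow z i)) =
     Cmul (edge_coef a D e (fst (snd e))) (Cmul (Cpow z (fst (fst e))) (Cprod_lin z Z)).
Proof.
  intros HD He. destruct (edge_coef_endpoints a D e HD He) as [N1 N2].
  pose proof He as [_ [H2 [Hlt _]]].
  destruct (finite_support_box a D HD _ H2) as [Hi _].
  apply (@Factorization.Csum_factor (edge_coef a D e)); try assumption; [lia|].
  intros i Hi'. now apply edge_coef_out.
Qed.

Lemma radius_bound (l : list Cx) : Forall (fun z => z <> C0) l ->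
  exists rad, 0 < rad /\ forall z, In z l -> / rad < Cmod z < rad.
Proof.
  induction 1 as [|z l Hz Hl [rad [Hr IH]]].
  - exists 1. split; [lra|]. intros z [].
  - pose proof (Cmod_pos z Hz) as Hp. pose proof (Rinv_0_lt_compat _ Hp) as Hi.
    exists (rad + Cmod z + / Cmod z). split; [lra|]. intros w [<-|Hw].
    + split; [|lra]. apply Rlt_le_trans with (/ / Cmod z); [|rewrite Rinv_inv; lra].
      apply Rinv_lt_contravar; [apply Rmult_lt_0_compat|]; lra.
    + destruct (IH w Hw) as [K1 K2]. split; [|lra].
      apply Rlt_trans with (/ rad); [|assumption].
      apply Rinv_lt_contravar; [apply Rmult_lt_0_compat|]; lra.
Qed.

Definition in_sector (alpha beta : R) (z : Cx) : bool := decP (sector alpha beta z).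

(** Two sectors are treated together because both bounds must hold for the same [y]. Finitely many
    conditions each hold for all large [n], so one [n] meets them all. The number of roots is exact
    since the coefficients at [imin] and [imax] belong to ends of edges and do not vanish for large
    [n]. *)
Lemma perturbed_sector_counts a D imin imax es theta (Zr : edge -> list Cx) a1 b1 a2 b2 :
  finite_support a D ->
  (forall q, supp a q -> (imin <= fst q <= imax)%nat) ->
  Forall (lower_edge (supp a)) es -> NoDup (map slope es) ->
  (exists e, In e es /\ fst (fst e) = imin) ->
  (exists e, In e es /\ fst (snd e) = imax) ->
  (forall e, In e es -> Forall (fun r => r <> C0) (Zr e) /\
    forall z, Csum D (fun i => Cmul (edge_coef a D e i) (Cpow z i)) =
     Cmul (edge_coef a D e (fst (snd e))) (Cmul (Cpow z (fst (fst e))) (Cprod_lin z (Zr e)))) ->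
  exists y rs, y <> C0 /\ nonzero_roots (fun x => eval2 a D x y) rs /\
    length rs = (imax - imin)%nat /\
    (list_sum (map (fun e => length (filter (in_sector a1 b1)
        (map (Cmul (cis (- (slope e * theta)))) (Zr e)))) es) <=
      length (filter (in_sector a1 b1) rs))%nat /\
    (list_sum (map (fun e => length (filter (in_sector a2 b2)
        (map (Cmul (cis (- (slope e * theta)))) (Zr e)))) es) <=
      length (filter (in_sector a2 b2) rs))%nat.
Proof.
  intros HD Hrange Hes Hnd [elo [Helo Elo]] [ehi [Hehi Ehi]] HZ.
  rewrite Forall_forall in Hes.
  destruct (radius_bound (flat_map Zr es)) as [rad [Hrad Hradz]].
  { apply Forall_forall. intros z Hz. apply in_flat_map in Hz. destruct Hz as [e [He Hz]].
    destruct (HZ e He) as [K _]. rewrite Forall_forall in K. now apply K. }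
  set (yn := fun n => Cmul (rexp (- INR n)) (cis theta)).
  assert (Hyn : forall n, yn n <> C0)
    by (intros n; apply Cmul_neq0; [apply rexp_neq0 | apply cis_neq0]).
  assert (Hout : forall n i, (i < imin)%nat \/ (imax < i)%nat -> ycoef a D (yn n) i = C0).
  { intros n i Hi. apply Csum_0. intros j _.
    destruct (excluded_middle_informative (a i j = C0)) as [E|E]; [rewrite E; ring|].
    specialize (Hrange (i, j) E). simpl in Hrange. lia. }
  assert (Hnz : forall e i, In e es -> edge_coef a D e i <> C0 ->
     eventually (fun n => ycoef a D (yn n) i <> C0)).
  { intros e i He Hc.
    assert (Lim := ycoef_limit a D e i theta (Hes e He)).
    apply Clim_eventually_neq0 in Lim; [|apply Cmul_neq0; [apply cis_neq0 | assumption]].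
    revert Lim. apply filter_imp. intros n Hn E. apply Hn. unfold yn in E. rewrite E. ring. }
  assert (Hlo : eventually (fun n => ycoef a D (yn n) imin <> C0)).
  { apply (Hnz elo imin Helo). rewrite <- Elo. now apply edge_coef_endpoints; auto. }
  assert (Hhi : eventually (fun n => ycoef a D (yn n) imax <> C0)).
  { apply (Hnz ehi imax Hehi). rewrite <- Ehi. now apply edge_coef_endpoints; auto. }
  assert (HimaxD : (imax < D)%nat).
  { rewrite <- Ehi. destruct (Hes ehi Hehi) as [_ [K _]].
    now destruct (finite_support_box a D HD _ K). }
  assert (Hii : (imin <= imax)%nat).
  { rewrite <- Ehi. destruct (Hes ehi Hehi) as [_ [K _]]. now destruct (Hrange _ K). }
  (* When an extreme coefficient vanishes, the list is [nil]; for such [n] only the length bound is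
     needed. *)
  assert (Hch : forall n, exists l, (length l <= imax - imin)%nat /\
    (ycoef a D (yn n) imin <> C0 -> ycoef a D (yn n) imax <> C0 ->
      length l = (imax - imin)%nat /\ Forall (fun r => r <> C0) l /\
      forall z, eval2 a D z (yn n) =
        Cmul (ycoef a D (yn n) imax) (Cmul (Cpow z imin) (Cprod_lin z l)))).
  { intros n. destruct (excluded_middle_informative
      (ycoef a D (yn n) imin <> C0 /\ ycoef a D (yn n) imax <> C0)) as [[N1 N2]|N].
    - destruct (@Factorization.Csum_factor (ycoef a D (yn n)) imin imax D Hii HimaxD N1 N2 (Hout n))
        as [l [H1 [H2 H3]]].
      exists l. split; [lia|]. intros _ _. split; [assumption|]. split; [assumption|].
      intros z. rewrite eval2_ycoef. apply H3.
    - exists nil. split; [simpl; lia|]. tauto. }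
  set (rs := fun n => proj1_sig (constructive_indefinite_description _ (Hch n))).
  assert (Hrs := fun n => proj2_sig (constructive_indefinite_description _ (Hch n))).
  change (forall n, (length (rs n) <= imax - imin)%nat /\
    (ycoef a D (yn n) imin <> C0 -> ycoef a D (yn n) imax <> C0 ->
      length (rs n) = (imax - imin)%nat /\ Forall (fun r => r <> C0) (rs n) /\
      forall z, eval2 a D z (yn n) =
        Cmul (ycoef a D (yn n) imax) (Cmul (Cpow z imin) (Cprod_lin z (rs n))))) in Hrs.
  clearbody rs.
  assert (Hcount : forall alpha beta, eventually (fun n => forall e, In e es ->
    (length (filter (root_region rad alpha beta) (map (Cmul (cis (- (slope e * theta)))) (Zr e))) <=
     length (filter (fun r => root_region rad alpha beta (Cmul (rexp (- (INR n * slope e))) r))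
                    (rs n)))%nat)).
  { intros alpha beta. apply eventually_forall_list. intros e He.
    apply (edge_root_count a D e theta (Zr e) imin imax); auto.
    - now apply edge_coef_endpoints; auto.
    - now apply HZ.
    - intros n. apply Hrs.
    - generalize (filter_and _ _ Hlo Hhi). apply filter_imp. intros n [N1 N2].
      now apply (Hrs n). }
  destruct (filter_and _ _
     (filter_and _ _ (filter_and _ _ Hlo Hhi) (scales_separate rad es Hrad Hnd))
     (filter_and _ _ (Hcount a1 b1) (Hcount a2 b2))) as [n Hn].
  destruct (Hn n (le_n _)) as [[[N1 N2] Hsep] [Hc1 Hc2]]. clear Hn.
  destruct (Hrs n) as [_ Hrn]. destruct (Hrn N1 N2) as [Hlen [Hne Hfac]].
  exists (yn n), (rs n). split; [apply Hyn|]. split.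
  { exists (ycoef a D (yn n) imax), imin. auto. }
  split; [assumption|].
  assert (Hndes : NoDup es) by (now apply NoDup_map_inv in Hnd).
  (* The regions of different edges are disjoint at this [n], so the counts may be added; the radial
     rescaling does not change the sector in which a root lies. *)
  assert (Fin : forall alpha beta, (forall e, In e es ->
    (length (filter (root_region rad alpha beta) (map (Cmul (cis (- (slope e * theta)))) (Zr e))) <=
     length (filter (fun r => root_region rad alpha beta (Cmul (rexp (- (INR n * slope e))) r))
                    (rs n)))%nat) ->
    (list_sum (map (fun e => length (filter (in_sector alpha beta)
        (map (Cmul (cis (- (slope e * theta)))) (Zr e)))) es) <=
      length (filter (in_sector alpha beta) (rs n)))%nat).
  { intros alpha beta Hc.
    eapply Nat.le_trans; [|apply (disjoint_filters_count es
      (fun e r => root_region rad alpha beta (Cmul (rexp (- (INR n * slope e))) r)) _ (rs n) Hndes)].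
    - apply list_sum_map_mono. intros e He. eapply Nat.le_trans; [|now apply Hc].
      apply filter_length_mono. intros z Hz Hs. apply decP_elim in Hs. apply decP_true.
      split; [assumption|]. apply in_map_iff in Hz. destruct Hz as [w [<- Hw]].
      rewrite Cmod_mul, Cmod_cis, Rmult_1_l. apply Hradz. apply in_flat_map. now exists e.
    - intros e e' r He He' _ H1 H2. apply decP_elim in H1, H2.
      apply (Hsep e He e' He' r); tauto.
    - intros e r He _ H1. apply decP_elim in H1. apply decP_true.
      destruct H1 as [H1 _]. apply (sector_scale _ _ (INR n * slope e)) in H1.
      replace (Cmul (rexp (INR n * slope e)) (Cmul (rexp (- (INR n * slope e))) r)) with r in H1;
        [assumption|].
      transitivity (Cmul (Cmul (rexp (INR n * slope e)) (rexp (- (INR n * slope e)))) r); [|ring].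
      rewrite rexp_opp. ring. }
  split; apply Fin; assumption.
Qed.

(** * Rotating the edges *)

Lemma divide_fact d D : (0 < d <= D)%nat -> exists c, fact D = (d * c)%nat.
Proof.
  induction D as [|D IH]; intros H; [lia|].
  destruct (Nat.eq_dec d (S D)) as [->|E]; [now exists (fact D)|].
  destruct IH as [c Hc]; [lia|]. exists (c * S D)%nat.
  change (fact (S D)) with (S D * fact D)%nat. rewrite Hc. lia.
Qed.

(** The denominator of the slope is a positive integer not exceeding [D], so it divides [D!]. The
    sign is that of the rotation by [- slope e * theta]. *)
Lemma slope_common_denominator a D e : finite_support a D -> lower_edge (supp a) e ->
  exists p : Z, IZR p = - (slope e * INR (fact D)).
Proof.
  intros HD [H1 [H2 [Hlt _]]].
  destruct (finite_support_box a D HD _ H2) as [Hi _].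
  destruct (divide_fact (fst (snd e) - fst (fst e)) D) as [c Hc]; [lia|].
  exists (- ((Z.of_nat (snd (snd e)) - Z.of_nat (snd (fst e))) * Z.of_nat c))%Z.
  rewrite opp_IZR, mult_IZR, minus_IZR, <- !INR_IZR_INZ, Hc, mult_INR, minus_INR by lia.
  apply lt_INR in Hlt. unfold slope. field. lra.
Qed.

Lemma choice_on {A B} (l : list A) (P : A -> B -> Prop) (b0 : B) :
  (forall x, In x l -> exists y, P x y) -> exists f, forall x, In x l -> P x (f x).
Proof.
  intros H.
  assert (K : forall x, exists y, In x l -> P x y).
  { intros x. destruct (excluded_middle_informative (In x l)) as [E|E].
    - destruct (H x E) as [y Hy]. now exists y.
    - exists b0. tauto. }
  exists (fun x => proj1_sig (constructive_indefinite_description _ (K x))).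
  intros x. exact (proj2_sig (constructive_indefinite_description _ (K x))).
Qed.

(** For integral [t] these are [M] equally spaced rays, permuted by every rotation by a multiple of
    [2 * PI / M]. If [d] keeps the unrotated limit roots off the rays, the rotated ones stay off as
    well. *)
Definition grid (M : nat) (d t : R) : R := 2 * PI * (t + d) / INR M.

Lemma grid_le M d s t : (0 < M)%nat -> s <= t -> grid M d s <= grid M d t.
Proof.
  intros HM H. apply lt_INR in HM. simpl in HM. pose proof PI_RGT_0.
  unfold grid, Rdiv. apply Rmult_le_compat_r; [left; now apply Rinv_0_lt_compat | nra].
Qed.

Lemma grid_lt M d s t : (0 < M)%nat -> s < t -> grid M d s < grid M d t.
Proof.
  intros HM H. apply lt_INR in HM. simpl in HM. pose proof PI_RGT_0.
  unfold grid, Rdiv. apply Rmult_lt_compat_r; [now apply Rinv_0_lt_compat | nra].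
Qed.

Lemma grid_turn M d t : (0 < M)%nat -> grid M d (t + INR M) = grid M d t + 2 * PI.
Proof. intros HM. apply lt_INR in HM. simpl in HM. unfold grid. field. lra. Qed.

Lemma residue_rotation (M : nat) (n p : Z) (v : nat) : (0 < M)%nat ->
  exists l : Z, Z.of_nat ((Z.to_nat (n mod Z.of_nat M) + Z.to_nat (p mod Z.of_nat M) * v) mod M)
    = (n + p * Z.of_nat v - Z.of_nat M * l)%Z.
Proof.
  intros HM.
  rewrite Nat2Z.inj_mod, Nat2Z.inj_add, Nat2Z.inj_mul, !Z2Nat.id
    by (apply Z.mod_pos_bound; lia).
  exists ((n + p * Z.of_nat v) / Z.of_nat M)%Z.
  rewrite Zplus_mod_idemp_l, <- Zplus_mod_idemp_r, Zmult_mod_idemp_l, Zplus_mod_idemp_r.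
  rewrite Z.mod_eq by lia. reflexivity.
Qed.

(** The rotation permutes the cells between consecutive rays and moves cell [n] to cell [n + p * v]
    modulo [M]. A point strictly inside its cell is never on a ray, so the window test on residues
    decides between two open sectors. *)
Lemma rotated_cell (M : nat) d phi rho (n p : Z) (v a b : nat) :
  (a < b)%nat -> (b < M)%nat -> 0 < rho ->
  IZR n < INR M * phi / (2 * PI) - d < IZR n + 1 ->
  let z := Cmul (cis (2 * PI * IZR p * INR v / INR M)) (rho * cos phi, rho * sin phi) in
  if in_window M a b (Z.to_nat (n mod Z.of_nat M) + Z.to_nat (p mod Z.of_nat M) * v)
  then sector (grid M d (INR a)) (grid M d (INR b)) z
  else sector (grid M d (INR b)) (grid M d (INR a) + 2 * PI) z.
Proof.
  intros Hab HbM Hrho Hn z.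
  assert (HM : (0 < M)%nat) by lia. pose proof (lt_INR _ _ HM) as HMR. simpl in HMR.
  pose proof PI_RGT_0 as HPI.
  unfold in_window.
  destruct (residue_rotation M n p v HM) as [l Hl].
  set (r := ((_ + _) mod M)%nat) in *.
  assert (HrM : (r < M)%nat) by (apply Nat.mod_upper_bound; lia).
  (* The argument after rotation, reduced by [l] full turns; [s] is its coordinate in grid steps and
     falls strictly inside cell [r]. *)
  set (psi := phi + 2 * PI * IZR p * INR v / INR M - 2 * PI * IZR l).
  set (s := INR M * psi / (2 * PI) - d).
  assert (Hs : INR r < s < INR r + 1).
  { rewrite INR_IZR_INZ, Hl, minus_IZR, plus_IZR, !mult_IZR, <- !INR_IZR_INZ.
    replace s with (INR M * phi / (2 * PI) - d + IZR p * INR v - INR M * IZR l).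
    - lra.
    - unfold s, psi. field. lra. }
  assert (Hpsi : psi = grid M d s) by (unfold s, grid; field; lra).
  assert (Hz : z = (rho * cos psi, rho * sin psi)).
  { unfold z.
    transitivity (Cmul (rho, 0) (Cmul (cis (2 * PI * IZR p * INR v / INR M)) (cis phi))).
    - unfold Cmul, cis; simpl. f_equal; ring.
    - rewrite <- cis_add.
      transitivity (Cmul (rho, 0) (cis psi)); [|unfold Cmul, cis; simpl; f_equal; ring].
      f_equal. unfold psi.
      rewrite cis_period. f_equal. ring. }
  assert (Hab' := lt_INR _ _ Hab). assert (HbM' := lt_INR _ _ HbM).
  pose proof (pos_INR a).
  destruct (Nat.leb_spec a r) as [H1|H1]; [destruct (Nat.ltb_spec r b) as [H2|H2]|]; simpl.
  - exists rho, psi. split; [assumption|]. split; [|assumption]. rewrite Hpsi.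
    apply le_INR in H1. assert (H2' : (r + 1 <= b)%nat) by lia.
    apply le_INR in H2'. rewrite plus_INR in H2'. simpl in H2'.
    split; apply grid_lt; lra || assumption.
  - exists rho, psi. split; [assumption|]. split; [|assumption]. rewrite Hpsi.
    rewrite <- grid_turn by assumption.
    apply le_INR in H2. assert (H3 : (r + 1 <= M)%nat) by lia.
    apply le_INR in H3. rewrite plus_INR in H3. simpl in H3.
    split; apply grid_lt; lra || assumption.
  (* The cell precedes the window, so one more turn is needed to reach the interval of grid
     coordinates from [b] to [a + M]. *)
  - exists rho, (psi + 2 * PI). split; [assumption|]. split.
    + rewrite Hpsi, <- !grid_turn by assumption.
      assert (H3 : (r + 1 <= a)%nat) by lia.
      apply le_INR in H3. rewrite plus_INR in H3. simpl in H3. pose proof (pos_INR r).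
      split; apply grid_lt; lra || assumption.
    + rewrite Hz. f_equal; f_equal.
      * symmetry. replace (psi + 2 * PI) with (psi + 2 * INR 1 * PI) by (simpl; ring).
        apply cos_period.
      * symmetry. replace (psi + 2 * PI) with (psi + 2 * INR 1 * PI) by (simpl; ring).
        apply sin_period.
Qed.

Lemma bias_exists rs v : bias_set rs v -> exists b, is_bias rs b /\ v <= b.
Proof.
  intros Hv.
  destruct (completeness (bias_set rs)) as [b Hb].
  - exists (INR (length rs) + INR (length rs)). intros w [alpha [beta [Hab [Hb ->]]]].
    pose proof PI_RGT_0.
    assert (HN : INR (N_ab alpha beta rs) <= INR (length rs))
      by (apply le_INR, filter_length_le).
    pose proof (pos_INR (N_ab alpha beta rs)). pose proof (pos_INR (length rs)).
    assert (HT : 0 <= INR (length rs) * (beta - alpha) / (2 * PI) <= INR (length rs)).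
    { split.
      - apply Rmult_le_pos; [nra | left; apply Rinv_0_lt_compat; lra].
      - apply Rmult_le_reg_r with (2 * PI); [lra|].
        unfold Rdiv. rewrite Rmult_assoc, Rinv_l by lra. nra. }
    apply Rabs_le. lra.
  - now exists v.
  - exists b. split; [assumption|]. now apply Hb.
Qed.

Lemma NoDup_map_transfer {A B C} (f : A -> B) (g : A -> C) l :
  NoDup (map f l) -> (forall x y, In x l -> In y l -> g x = g y -> f x = f y) ->
  NoDup (map g l).
Proof.
  induction l as [|x l IH]; simpl; intros Hnd H; [constructor|].
  inversion Hnd as [|? ? Hni Hnd']; subst. constructor.
  - intros Hin. apply in_map_iff in Hin. destruct Hin as [y [E Hy]].
    apply Hni. rewrite (H x y); auto. now apply in_map.
  - apply IH; auto.
Qed.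

Lemma Z_list_bound {A} (f : A -> Z) l :
  exists B : nat, forall x, In x l -> (Z.abs (f x) <= Z.of_nat B)%Z.
Proof.
  induction l as [|x l [B HB]]; [exists O; intros x []|].
  exists (B + Z.abs_nat (f x))%nat. intros y [<-|Hy]; [lia|].
  specialize (HB y Hy). lia.
Qed.

Lemma lower_hull_bias a D imin imax es :
  finite_support a D -> es <> nil ->
  (forall q, supp a q -> (imin <= fst q <= imax)%nat) ->
  Forall (lower_edge (supp a)) es -> NoDup (map slope es) ->
  list_sum (map width es) = (imax - imin)%nat ->
  (exists e, In e es /\ fst (fst e) = imin) ->
  (exists e, In e es /\ fst (snd e) = imax) ->
  exists y, y <> C0 /\ exists rs b,
    nonzero_roots (fun x => eval2 a D x y) rs /\ is_bias rs b /\
    sqrt (INR (length es)) / 6 <= b.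
Proof.
  intros HD Hne Hrange Hes Hnd Hsum Hlo Hhi.
  pose proof Hes as Hes'. rewrite Forall_forall in Hes'.
  destruct (choice_on es (fun e Z => length Z = width e /\ Forall (fun r => r <> C0) Z /\
    forall z, Csum D (fun i => Cmul (edge_coef a D e i) (Cpow z i)) =
     Cmul (edge_coef a D e (fst (snd e))) (Cmul (Cpow z (fst (fst e))) (Cprod_lin z Z))) nil)
    as [Zr HZr].
  { intros e He. apply edge_roots; auto. }
  destruct (choice_on es (fun e p => IZR p = - (slope e * INR (fact D))) 0%Z) as [p Hp].
  { intros e He. apply (slope_common_denominator a D e); auto. }
  destruct (Z_list_bound p es) as [B HB].
  (* [M > D] makes every width less than [M], and [M > 2 * B] keeps the distinct integers [p e]
     distinct modulo [M]. *)
  destruct (Residues.large_discrepancy_mod_prime (D + 2 * B)) as [M [HM Hdisc]].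
  assert (HM0 : (0 < M)%nat) by lia. pose proof (lt_INR _ _ HM0) as HMR. simpl in HMR.
  pose proof PI_RGT_0 as HPI.
  destruct (choice_on (flat_map Zr es)
    (fun z phi => exists rho, 0 < rho /\ z = (rho * cos phi, rho * sin phi)) 0) as [ang Hang].
  { intros z Hz. apply polar. apply in_flat_map in Hz. destruct Hz as [e [He Hz]].
    destruct (HZr e He) as [_ [K _]]. rewrite Forall_forall in K. now apply K. }
  set (pos := fun z => INR M * ang z / (2 * PI)).
  (* [pos] is the angle of a limit root in grid steps. An offset different from all its fractional
     parts puts every limit root strictly inside a cell. *)
  destruct (exists_small_avoiding 1 (map (fun z => frac_part (pos z)) (flat_map Zr es)) Rlt_0_1)
    as [d [Hd Hdav]].
  set (cell := fun z => Int_part (pos z - d)).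
  assert (Hcell : forall z, In z (flat_map Zr es) ->
    IZR (cell z) < INR M * ang z / (2 * PI) - d < IZR (cell z) + 1).
  { intros z Hz. fold (pos z). unfold cell.
    destruct (base_Int_part (pos z - d)) as [K1 K2]. split; [|lra].
    destruct K1 as [K1|K1]; [assumption|]. exfalso. apply Hdav.
    apply in_map_iff. exists z. split; [|assumption].
    set (k := Int_part (pos z - d)) in *. unfold frac_part.
    replace (Int_part (pos z)) with k; [lra|].
    apply Int_part_spec. lra. }
  set (idx := fun z => Z.to_nat (cell z mod Z.of_nat M)).
  set (pr := fun e => Z.to_nat (p e mod Z.of_nat M)).
  assert (Hmod : forall k, (0 <= k mod Z.of_nat M < Z.of_nat M)%Z)
    by (intros; apply Z.mod_pos_bound; lia).
  destruct (Hdisc (map (fun e => (pr e, map idx (Zr e))) es)) as [v [a0 [b0 [Hab [HbM HW]]]]].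
  { destruct es; [congruence | discriminate]. }
  { rewrite map_map. simpl. apply (NoDup_map_transfer slope); [assumption|].
    intros e e' He He' E. unfold pr in E.
    apply Z2Nat.inj in E; try apply Hmod.
    assert (Ep : p e = p e').
    { pose proof (HB e He). pose proof (HB e' He').
      pose proof (Z.div_mod (p e) (Z.of_nat M) ltac:(lia)) as D1.
      pose proof (Z.div_mod (p e') (Z.of_nat M) ltac:(lia)) as D2.
      rewrite E in D1.
      set (q := (p e / Z.of_nat M)%Z) in *. set (q' := (p e' / Z.of_nat M)%Z) in *.
      assert (q = q') by nia. congruence. }
    pose proof (Hp e He) as P1. pose proof (Hp e' He') as P2. rewrite Ep in P1.
    assert (0 < INR (fact D)) by (apply lt_0_INR, lt_O_fact). nra. }
  { intros x Hx. apply in_map_iff in Hx. destruct Hx as [e [<- He]]. simpl.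
    pose proof (Hes' e He) as [_ [K2 [Klt _]]].
    destruct (finite_support_box a D HD _ K2) as [Ki _].
    destruct (HZr e He) as [Hlen _]. unfold width in Hlen.
    split; [|split; [|split]].
    - unfold pr. pose proof (Hmod (p e)). lia.
    - rewrite length_map. lia.
    - rewrite length_map. lia.
    - apply Forall_forall. intros x Hx. apply in_map_iff in Hx. destruct Hx as [z [<- _]].
      unfold idx. pose proof (Hmod (cell z)). lia. }
  cbv zeta in HW. rewrite length_map, !map_map in HW. cbn [fst snd] in HW.
  (* With the factor [D!], the angle [- slope e * theta] is exactly [p e * v] grid steps for every
     edge. *)
  set (theta := 2 * PI * INR (fact D) * INR v / INR M).
  set (alpha := grid M d (INR a0)). set (beta := grid M d (INR b0)).
  destruct (perturbed_sector_counts a D imin imax es theta Zr alpha beta beta (alpha + 2 * PI))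
    as [y [rs [Hy [Hroots [Hlen [Hc1 Hc2]]]]]]; auto.
  { intros e He. destruct (HZr e He) as [_ K]. exact K. }
  set (win := fun e z => in_window M a0 b0 (idx z + pr e * v)).
  set (cnt := list_sum (map (fun e => length (filter (win e) (Zr e))) es)).
  set (cnt' := list_sum (map (fun e => length (filter (fun z => negb (win e z)) (Zr e))) es)).
  assert (Hrot : forall e z, In e es -> In z (Zr e) ->
    if win e z then sector alpha beta (Cmul (cis (- (slope e * theta))) z)
    else sector beta (alpha + 2 * PI) (Cmul (cis (- (slope e * theta))) z)).
  { intros e z He Hz. assert (Hz' : In z (flat_map Zr es)) by (apply in_flat_map; now exists e).
    destruct (Hang z Hz') as [rho [Hrho Ez]].
    replace (- (slope e * theta)) with (2 * PI * IZR (p e) * INR v / INR M).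
    - pose proof (rotated_cell M d (ang z) rho (cell z) (p e) v a0 b0 Hab HbM Hrho (Hcell z Hz'))
        as K.
      cbv zeta in K. rewrite <- Ez in K. exact K.
    - rewrite (Hp e He). unfold theta. field. lra. }
  assert (Hcnt : (cnt <= length (filter (in_sector alpha beta) rs))%nat).
  { eapply Nat.le_trans; [|exact Hc1]. apply list_sum_map_mono. intros e He.
    rewrite filter_map_length. apply filter_length_mono. intros z Hz Hw.
    apply decP_true. pose proof (Hrot e z He Hz) as K. now rewrite Hw in K. }
  assert (Hcnt' : (cnt' <= length (filter (in_sector beta (alpha + 2 * PI)) rs))%nat).
  { eapply Nat.le_trans; [|exact Hc2]. apply list_sum_map_mono. intros e He.
    rewrite filter_map_length. apply filter_length_mono. intros z Hz Hw.
    apply decP_true. pose proof (Hrot e z He Hz) as K.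
    destruct (win e z); [discriminate | exact K]. }
  assert (Htot : list_sum (map (fun e => length (Zr e)) es) = length rs).
  { rewrite Hlen, <- Hsum. f_equal. apply map_ext_in. intros e He. now apply HZr. }
  assert (Hsplit : (cnt + cnt' = length rs)%nat).
  { rewrite <- Htot. unfold cnt, cnt'. clear. induction es as [|e l IH]; simpl; [reflexivity|].
    pose proof (filter_length (win e) (Zr e)). lia. }
  assert (Ha : 0 <= alpha).
  { unfold alpha, grid. apply Rmult_le_pos; [|left; now apply Rinv_0_lt_compat].
    pose proof (pos_INR a0). nra. }
  assert (Hb : beta <= 2 * PI).
  { apply Rle_trans with (grid M d (INR M - d)).
    - apply grid_le; [assumption|]. assert (K : (b0 + 1 <= M)%nat) by lia.
      apply le_INR in K. rewrite plus_INR in K. simpl in K. lra.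
    - unfold grid. right. field. lra. }
  assert (Hablt : alpha < beta) by (apply grid_lt; [|apply lt_INR]; assumption).
  (* Here the two lower bounds become equalities: [cnt] and [cnt'] bound the numbers of roots with
     and without an argument in the closed interval, and both pairs add up to [length rs]. *)
  assert (HN : N_ab alpha beta rs = cnt).
  { unfold N_ab. set (f := fun r => decP _).
    assert (K1 : (length (filter (in_sector alpha beta) rs) <= length (filter f rs))%nat).
    { apply filter_length_mono. intros r _ Hr. apply decP_elim in Hr. apply decP_true.
      now apply sector_has_arg. }
    assert (K2 : (length (filter (in_sector beta (alpha + 2 * PI)) rs) <=
                  length (filter (fun r => negb (f r)) rs))%nat).
    { apply filter_length_mono. intros r _ Hr. apply decP_elim in Hr.
      destruct (f r) eqn:E; [|reflexivity]. apply decP_elim in E.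
      now apply sector_complement_has_arg in Hr. }
    pose proof (filter_length f rs). lia. }
  set (val := Rabs (INR (N_ab alpha beta rs) - INR (length rs) * (beta - alpha) / (2 * PI))).
  destruct (bias_exists rs val) as [b [Hbias Hvb]].
  { exists alpha, beta. split; [lra|]. split; [assumption | reflexivity]. }
  exists y. split; [assumption|]. exists rs, b. split; [assumption|]. split; [assumption|].
  apply Rle_trans with (2 := Hvb).
  assert (Ecnt : list_sum (map (fun e => length (filter
     (fun x => in_window M a0 b0 (x + pr e * v)) (map idx (Zr e)))) es) = cnt).
  { unfold cnt. f_equal. apply map_ext. intros e.
    apply (filter_map_length (fun x => in_window M a0 b0 (x + pr e * v)) idx). }
  assert (Etot : list_sum (map (fun e => length (map idx (Zr e))) es) = length rs).
  { rewrite <- Htot. f_equal. apply map_ext. intros e. apply length_map. }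
  assert (HWZ : (Z.of_nat (length es) * (Z.of_nat M * Z.of_nat M) <=
    36 * ((Z.of_nat M * Z.of_nat cnt - Z.of_nat (length rs) * Z.of_nat (b0 - a0)) *
          (Z.of_nat M * Z.of_nat cnt - Z.of_nat (length rs) * Z.of_nat (b0 - a0))))%Z)
    by (rewrite <- Ecnt, <- Etot; exact HW).
  apply IZR_le in HWZ.
  set (W := INR M * INR cnt - INR (length rs) * (INR b0 - INR a0)).
  assert (HW' : INR (length es) * (INR M * INR M) <= 36 * (W * W)).
  { rewrite !mult_IZR, minus_IZR, !mult_IZR, <- !INR_IZR_INZ, minus_INR in HWZ by lia.
    exact HWZ. }
  assert (Eval : val * INR M = Rabs W).
  { unfold val. rewrite HN. rewrite <- (Rabs_right (INR M)) at 1 by lra.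
    rewrite <- Rabs_mult. f_equal. unfold W, alpha, beta, grid. field. lra. }
  assert (Hval : 0 <= val) by apply Rabs_pos.
  assert (HK : INR (length es) <= (6 * val) * (6 * val)).
  { apply Rmult_le_reg_r with (INR M * INR M); [nra|].
    apply Rle_trans with (1 := HW'). right.
    transitivity (36 * ((val * INR M) * (val * INR M))); [|ring].
    rewrite Eval. f_equal. pose proof (Rsqr_abs W) as K. unfold Rsqr in K. exact K. }
  apply sqrt_le_1_alt in HK. rewrite sqrt_square in HK; lra.
Qed.

(** * Inversion of y and the choice between the two chains *)

Lemma Csum_reverse n F : Csum n (fun j => F (n - 1 - j)%nat) = Csum n F.
Proof.
  revert F. induction n as [|n IH]; intros F; [reflexivity|].
  assert (Hl : forall m G, Csum (S m) G = Cadd (G O) (Csum m (fun j => G (S j)))).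
  { intros m G. induction m as [|m IHm]; [simpl; ring|].
    change (Csum (S (S m)) G) with (Cadd (Csum (S m) G) (G (S m))). rewrite IHm.
    simpl. ring. }
  rewrite Hl. change (Csum (S n) F) with (Cadd (Csum n F) (F n)).
  rewrite <- (IH F).
  replace (S n - 1 - 0)%nat with n by lia.
  rewrite (Csum_ext n (fun j => F (S n - 1 - S j)%nat) (fun j => F (n - 1 - j)%nat)).
  - ring.
  - intros j Hj. f_equal. lia.
Qed.

(** For fixed [y] the factor [y^(D - 1)] is a nonzero constant, so both sides have the same roots in
    [x], and a large bias found for the flipped polynomial at [1 / y] is one for the original at
    [y]. *)
Lemma eval2_flip a D x y y' : Cmul y y' = C1 ->
  eval2 a D x y = Cmul (Cpow y (D - 1)) (eval2 (flip_coef D a) D x y').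
Proof.
  intros Hy. rewrite !eval2_ycoef, Csum_mul_l. apply Csum_ext. intros i _.
  transitivity (Cmul (Cmul (Cpow y (D - 1)) (ycoef (flip_coef D a) D y' i)) (Cpow x i));
    [|ring].
  f_equal. unfold ycoef. rewrite Csum_mul_l, <- Csum_reverse. apply Csum_ext. intros j Hj.
  unfold flip_coef. destruct (Nat.ltb_spec j D); [|lia].
  assert (Hpow : forall m, Cmul (Cpow y m) (Cpow y' m) = C1).
  { intros m. rewrite <- Cpow_mul, Hy. induction m as [|m IHm]; simpl; [reflexivity|].
    rewrite IHm. ring. }
  assert (Hadd : forall m k, Cpow y (m + k) = Cmul (Cpow y m) (Cpow y k)).
  { intros m k. induction m as [|m IHm]; simpl; [ring|]. rewrite IHm. ring. }
  replace (Cpow y (D - 1)) with (Cmul (Cpow y (D - 1 - j)) (Cpow y j)).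
  - transitivity (Cmul (Cmul (a i (D - 1 - j)%nat) (Cpow y (D - 1 - j)))
                       (Cmul (Cpow y j) (Cpow y' j))); [rewrite Hpow|]; ring.
  - rewrite <- Hadd. f_equal. lia.
Qed.

Lemma nonzero_roots_scale g h k rs : k <> C0 -> (forall z, g z = Cmul k (h z)) ->
  nonzero_roots h rs -> nonzero_roots g rs.
Proof.
  intros Hk Hg [c [m [Hc [Hrs Hh]]]]. exists (Cmul k c), m.
  split; [now apply Cmul_neq0|]. split; [assumption|].
  intros z. rewrite Hg, Hh. ring.
Qed.

(** The assumption [4 <= k] gives [1 <= l], hence [k <= 2 * l + 2 <= 4 * l] and sqrt k <= 2 sqrt l;
    this turns 1/6 into 1/12. *)
Lemma large_bias_of_edge_count k l b : (4 <= k)%nat -> (k <= 2 * (l + 1))%nat ->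
  sqrt (INR l) / 6 <= b -> / 12 * sqrt (INR k) <= b.
Proof.
  intros Hk Hkl Hb.
  assert (K : INR k <= 2 * 2 * INR l).
  { assert (k <= 4 * l)%nat by lia. apply le_INR in H. rewrite mult_INR in H. simpl in H. lra. }
  apply sqrt_le_1_alt in K. rewrite sqrt_mult, sqrt_square in K; [lra|lra|lra|apply pos_INR].
Qed.

Theorem theorem2p2 :
  exists (c : R) (k0 : nat), 0 < c /\
    forall (k : nat) (a : nat -> nat -> Cx) (D : nat),
      (k0 <= k)%nat ->
      finite_support a D ->
      newt_num_vertices a k ->
      exists y : Cx, y <> C0 /\
        exists (rs : list Cx) (b : R),
          nonzero_roots (fun x => eval2 a D x y) rs /\
          is_bias rs b /\
          c * sqrt (INR k) <= b.
Proof.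
  exists (/ 12), 4%nat. split; [lra|].
  intros k a D Hk HD [verts [Hnd [Hlen Hverts]]].
  assert (Hex : exists q, supp a q).
  { destruct verts as [|q verts]; [simpl in Hlen; lia|].
    exists q. apply (Hverts q). now left. }
  assert (HDf := finite_support_flip a D HD).
  assert (HB := finite_support_box a D HD). assert (HBf := finite_support_box _ D HDf).
  assert (Hexf : exists q, supp (flip_coef D a) q).
  { destruct Hex as [q Hq]. exists (flip D q). destruct (HB q Hq) as [_ Hj].
    apply supp_flip; [unfold flip; simpl; lia|]. now rewrite flipK. }
  destruct (lower_hull (supp a) D HB Hex)
    as [i1 [i2 [vs [es [_ [Lvs [Hvs [Hr [He [Hs [Hsum [Hends Hcov]]]]]]]]]]]].
  destruct (lower_hull (supp (flip_coef D a)) D HBf Hexf)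
    as [i1' [i2' [vs' [es' [_ [Lvs' [Hvs' [Hr' [He' [Hs' [Hsum' [Hends' Hcov']]]]]]]]]]]].
  (* A chain has one more vertex than edges, and the two chains together contain all vertices. With
     [l] the larger number of edges, [k <= 2 * (l + 1)]. *)
  assert (Hcount : (k <= (length es + 1) + (length es' + 1))%nat).
  { rewrite <- Lvs, <- Lvs', <- Hlen, <- (length_map (flip D) vs'), <- length_app.
    apply NoDup_incl_length; [assumption|]. intros q Hq.
    apply (newt_vertex_on_chains a D); auto. now apply Hverts. }
  assert (Hwide : forall P (l : list edge) m m', Forall (lower_edge P) l -> l <> nil ->
     list_sum (map width l) = (m' - m)%nat -> (m < m')%nat).
  { intros P [|e l] m m' HF Hne E; [congruence|].
    inversion HF as [|? ? [_ [_ [Hlt _]]] _]; subst. simpl in E. unfold width in E at 1. lia. }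
  destruct (le_lt_dec (length es') (length es)) as [Hc|Hc].
  - assert (Hne : es <> nil) by (intros ->; simpl in *; lia).
    destruct (Hends (Hwide _ _ _ _ He Hne Hsum)) as [K1 K2].
    destruct (lower_hull_bias a D i1 i2 es) as [y [Hy [rs [b [R1 [R2 R3]]]]]]; auto.
    exists y. split; [assumption|]. exists rs, b. split; [assumption|]. split; [assumption|].
    apply (large_bias_of_edge_count k (length es)); auto; lia.
  - assert (Hne : es' <> nil) by (intros ->; simpl in *; lia).
    destruct (Hends' (Hwide _ _ _ _ He' Hne Hsum')) as [K1 K2].
    destruct (lower_hull_bias (flip_coef D a) D i1' i2' es')
      as [y [Hy [rs [b [R1 [R2 R3]]]]]]; auto.
    assert (Hinv : Cmul (Cinv y) y = C1) by (field; exact Hy).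
    assert (Hy' : Cinv y <> C0).
    { intros E. rewrite E in Hinv. apply C1_neq0. rewrite <- Hinv. ring. }
    exists (Cinv y). split; [assumption|]. exists rs, b.
    split; [|split; [assumption | apply (large_bias_of_edge_count k (length es')); auto; lia]].
    apply (nonzero_roots_scale _ (fun x => eval2 (flip_coef D a) D x y) (Cpow (Cinv y) (D - 1)));
      [now apply Cpow_neq0 | | assumption].
    intros x. now apply eval2_flip.
Qed.
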